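(* Let $\alpha\in\mathbb{R}\setminus\{0\}$ and let $(\triangle_{2,s})_{s>0}$ be a family of self-adjoint operators on $M_2$ such that $\triangle_{2,1}=\triangle_2$ and such that, for every $s>0$ and every $j\in\mathbb{N}^*$, the $j$-th (distinct) eigenvalue of $\triangle_{2,s}$ is $s^\alpha\lambda^2_j$. Then the set of $s>0$ such that the spectrum of $\triangle_1+\triangle_{2,s}$ does not satisfy (MM) is at most countable.
   Context: For $\ell=1,2$, $M_\ell$ is a smooth compact manifold endowed with a Borel probability measure $\rho_\ell$, and $\triangle_\ell$ is a self-adjoint operator on $L^2(M_\ell,\rho_\ell)$, bounded below and with compact resolvent, with distinct eigenvalues $\lambda^\ell_1<\lambda^\ell_2<\cdots<\lambda^\ell_i<\cdots$, $\lambda^\ell_i\to+\infty$, each of finite multiplicity; $\mathbb{N}^*=\{1,2,\dots\}$. The operators $\triangle_{2,s}$ are of the same type as $\triangle_2$ (bounded below, with compact resolvent). Here $\triangle_1+\triangle_{2,s}$ denotes the operator $\triangle_1\otimes\mathrm{id}_{M_2}+\mathrm{id}_{M_1}\otimes\triangle_{2,s}$ on the product $M_1\times M_2$, whose eigenvalues are the sums of an eigenvalue of $\triangle_1$ and an eigenvalue of $\triangle_{2,s}$. (MM) (minimal multiplicity property), for a sum $D_1\otimes\mathrm{id}+\mathrm{id}\otimes D_2$ where $D_\ell$ has distinct eigenvalues $\nu^\ell_1<\nu^\ell_2<\cdots$ of multiplicities $m^\ell_i$: for all $i,j\in\mathbb{N}^*$, the multiplicity $m_{i,j}$ of $\nu^1_i+\nu^2_j$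 as an eigenvalue of the sum operator equals $m^1_i m^2_j$. Equivalently: for all $i,j,i',j'\in\mathbb{N}^*$, $\nu^1_i+\nu^2_j=\nu^1_{i'}+\nu^2_{j'}$ implies $i=i'$ and $j=j'$. *)

(* Defs.v *)
From HB Require Import structures.
From mathcomp Require Import all_boot all_order all_algebra.
From mathcomp Require Import all_classical all_reals all_analysis.
From mathcomp Require Import complex.

Set Implicit Arguments.
Unset Strict Implicit.
Unset Printing Implicit Defensive.

Import Order.TTheory GRing.Theory Num.Theory.
Import numFieldTopology.Exports numFieldNormedType.Exports.

Local Open Scope classical_set_scope.
Local Open Scope ring_scope.
Local Open Scope complex_scope.

Section SmoothManifold.
Context {R : realType} {n : nat}.

(* For U open, this is the usual class C^k(U) : 'D_v f x at a point of U only
   depends on f near x, so values of f outside U are irrelevant. *)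
Fixpoint Ck_on (k : nat) (U : set 'rV[R]_n) (f : 'rV[R]_n -> R) : Prop :=
  {in U, continuous f} /\
  if k is k'.+1 then
    forall i : 'I_n, (forall x, U x -> derivable f x (delta_mx 0 i)) /\
      Ck_on k' U (fun x => 'D_(delta_mx 0 i) f x)
  else True.

Definition smooth_on (U : set 'rV[R]_n) (f : 'rV[R]_n -> 'rV[R]_n) : Prop :=
  forall (i : 'I_n) (k : nat), Ck_on k U (fun x => f x 0 i).

Context {M : topologicalType}.

(* Local coordinates; chart_map is meaningful on chart_dom only, and chart_inv
   on the image of chart_dom only. *)
Record chart := Chart {
  chart_dom : set M;
  chart_map : M -> 'rV[R]_n;
  chart_inv : 'rV[R]_n -> M }.

Definition chart_img (c : chart) : set 'rV[R]_n := chart_map c @` chart_dom c.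

Definition is_chart (c : chart) : Prop :=
  [/\ open (chart_dom c), open (chart_img c),
      {in chart_dom c, cancel (chart_map c) (chart_inv c)},
      {in chart_dom c, continuous (chart_map c)} &
      {in chart_img c, continuous (chart_inv c)}].

Definition smooth_atlas (A : set chart) : Prop :=
  [/\ forall c, A c -> is_chart c,
      forall p : M, exists2 c, A c & chart_dom c p &
      forall c c', A c -> A c' ->
        smooth_on (chart_map c @` (chart_dom c `&` chart_dom c'))
                  (chart_map c' \o chart_inv c)].

(* Second countability follows from compactness. *)
Definition compact_smooth_manifold (A : set chart) : Prop :=
  [/\ compact [set: M], hausdorff_space M & smooth_atlas A].

End SmoothManifold.
Arguments chart : clear implicits.

Notation borel M := (g_sigma_algebraType (@open M)).

(* Unbounded operators are given by their graphs: G f g means that f belongs to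
   the domain and that g is the image of f. *)
Definition operator_graph (T : Type) (R : realType) :=
  (T -> R[i]) -> (T -> R[i]) -> Prop.

(* The complex Hilbert space L^2(T, mu). Its elements are represented by
   square-integrable functions T -> R[i], equality in L^2 being equality
   almost everywhere. *)
Section L2.
Context {d} {T : measurableType d} {R : realType}.
Variable mu : {measure set T -> \bar R}.

Definition L2 : set (T -> R[i]) :=
  [set f | (fun x => complex.Re (f x)) \in Lfun mu 2%:E /\
           (fun x => complex.Im (f x)) \in Lfun mu 2%:E].

Definition dotL2 (f g : T -> R[i]) : R[i] :=
  let h x := f x * conjc (g x) in
  (\int[mu]_x complex.Re (h x)) +i* (\int[mu]_x complex.Im (h x)).

Definition normL2 (f : T -> R[i]) : R := Num.sqrt (complex.Re (dotL2 f f)).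

Definition aeq (f g : T -> R[i]) : Prop := {ae mu, forall x, f x = g x}.

Implicit Type G : operator_graph T R.

Definition linear_operator G : Prop :=
  [/\ forall f g, G f g -> L2 f /\ L2 g,
      forall f f' g g', L2 f' -> L2 g' -> aeq f f' -> aeq g g' ->
        G f g -> G f' g',
      forall f g g', G f g -> G f g' -> aeq g g',
      G (fun=> 0) (fun=> 0) &
      forall (a : R[i]) f f' g g', G f g -> G f' g' ->
        G (fun x => a * f x + f' x) (fun x => a * g x + g' x)].

Definition densely_defined G : Prop :=
  forall f, L2 f -> forall e : R, 0 < e ->
    exists u v, G u v /\ normL2 (fun x => f x - u x) < e.

Definition adjoint G : operator_graph T R := fun u v =>
  [/\ L2 u, L2 v & forall f g, G f g -> dotL2 g u = dotL2 f v].

Definition self_adjoint G : Prop :=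
  [/\ linear_operator G, densely_defined G &
      forall u v, G u v <-> adjoint G u v].

Definition bounded_below G : Prop :=
  exists c : R, forall f g, G f g ->
    c * normL2 f ^+ 2 <= complex.Re (dotL2 g f).

(* The graph of (G - z)^-1. *)
Definition resolvent G (z : R[i]) : operator_graph T R := fun h f =>
  L2 h /\ exists g, G f g /\ aeq h (fun x => g x - z * f x).

Definition resolvent_set G (z : R[i]) : Prop :=
  [/\ forall h, L2 h -> exists f, resolvent G z h f,
      forall h f f', resolvent G z h f -> resolvent G z h f' -> aeq f f' &
      exists C : R, forall h f, resolvent G z h f -> normL2 f <= C * normL2 h].

Definition compact_operator (K : operator_graph T R) : Prop :=
  forall f g : nat -> T -> R[i], (forall k, K (f k) (g k)) ->
    (exists C : R, forall k, normL2 (f k) <= C) ->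
    exists (sigma : nat -> nat) (u : T -> R[i]),
      [/\ {homo sigma : i j / (i < j)%N}, L2 u &
          normL2 (fun x => g (sigma k) x - u x) @[k --> \oo] --> (0 : R)].

Definition compact_resolvent G : Prop :=
  exists z : R[i], resolvent_set G z /\ compact_operator (resolvent G z).

Definition eigenfunction G (z : R[i]) (f : T -> R[i]) : Prop :=
  G f (fun x => z * f x).

Definition eigenvalue G (z : R[i]) : Prop :=
  exists f, eigenfunction G z f /\ ~ aeq f (fun=> 0).

(* The eigenspace of z has a basis of m elements. *)
Definition multiplicity G (z : R[i]) (m : nat) : Prop :=
  exists e : 'I_m -> T -> R[i],
  [/\ forall k, eigenfunction G z (e k),
      forall a : 'I_m -> R[i],
        aeq (fun x => \sum_k a k * e k x) (fun=> 0) -> forall k, a k = 0 &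
      forall f, eigenfunction G z f ->
        exists a : 'I_m -> R[i], aeq f (fun x => \sum_k a k * e k x)].

(* The eigenvalue with index i in {1, 2, ...} is nu (i - 1). *)
Definition distinct_eigenvalues G (nu : nat -> R) : Prop :=
  [/\ {homo nu : i j / (i < j)%N >-> i < j},
      nu k @[k --> \oo] --> +oo,
      forall z, eigenvalue G z <-> exists i, z = (nu i)%:C &
      forall i, exists m, multiplicity G (nu i)%:C m].

Definition laplace_type G (nu : nat -> R) : Prop :=
  [/\ self_adjoint G, bounded_below G, compact_resolvent G &
      distinct_eigenvalues G nu].

Definition closure_graph G : operator_graph T R := fun u v =>
  [/\ L2 u, L2 v & forall e : R, 0 < e -> exists u' v',
      [/\ G u' v', normL2 (fun x => u x - u' x) < e &
          normL2 (fun x => v x - v' x) < e]].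

End L2.

Section TensorSum.
Context {d1 d2} {T1 : measurableType d1} {T2 : measurableType d2}
  {R : realType}.

(* G1 (x) id + id (x) G2 on finite sums of tensors of elements of the domains *)
Definition algebraic_tensor_sum
    (G1 : operator_graph T1 R) (G2 : operator_graph T2 R) :
    operator_graph (T1 * T2)%type R := fun u v =>
  exists (n : nat) (f f' : 'I_n -> T1 -> R[i]) (g g' : 'I_n -> T2 -> R[i]),
  [/\ forall k, G1 (f k) (f' k) /\ G2 (g k) (g' k),
      u = (fun x => \sum_k f k x.1 * g k x.2) &
      v = (fun x => \sum_k (f' k x.1 * g k x.2 + f k x.1 * g' k x.2))].

Variables (rho1 : probability T1 R) (rho2 : probability T2 R).

(* For self-adjoint G1 and G2 the algebraic sum is essentially self-adjoint,
   and its closure is the self-adjoint operator G1 (x) id + id (x) G2. *)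
Definition tensor_sum (G1 : operator_graph T1 R) (G2 : operator_graph T2 R) :
    operator_graph (T1 * T2)%type R :=
  closure_graph (rho1 \x rho2)%E (algebraic_tensor_sum G1 G2).

Definition MM (G1 : operator_graph T1 R) (nu1 : nat -> R)
    (G2 : operator_graph T2 R) (nu2 : nat -> R) : Prop :=
  forall (i j m1 m2 : nat),
    multiplicity rho1 G1 (nu1 i)%:C m1 ->
    multiplicity rho2 G2 (nu2 j)%:C m2 ->
    multiplicity (rho1 \x rho2)%E (tensor_sum G1 G2)
      (nu1 i + nu2 j)%:C (m1 * m2)%N.

End TensorSum.

(* Main.v *)
Require Import Defs.
From mathcomp Require Import all_boot all_order all_algebra.
From mathcomp Require Import all_classical all_reals all_analysis.
From mathcomp Require Import measurable_realfun complex ring lra.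

(** Fix s and suppose that nu1 i + nu2 j = nu1 i' + nu2 j' only when (i, j) =
    (i', j'), for nu1 and nu2 the eigenvalues of the two factors. Then (MM) holds
    ([multiplicity_tensor_sum]): tensors e_k (x) f_l of bases of the eigenspaces
    of nu1 i and nu2 j are eigenfunctions of the tensor sum for
    mu = nu1 i + nu2 j, and they are independent. They also span. The tensor sum
    is the closure of a symmetric operator, so an eigenfunction u for mu is
    orthogonal to f (x) g whenever f and g are eigenfunctions of the factors
    whose eigenvalues do not add up to mu ([tensor_sum_orth]). The Gram matrices
    of the e_k and of the f_l are invertible, which gives a combination u0 of
    the e_k (x) f_l such that u - u0 is orthogonal to all of them. In the absence
    of coincidences u - u0 is then orthogonal to all tensors of eigenfunctions,
    and it vanishes because tensors of complete families are complete
    ([tensor_complete], by slicing with Fubini).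

    Completeness of the eigenfunctions of an operator G with compact resolvent
    K = (G - z)^-1 is proved in an arbitrary pre-Hilbert space
    ([eigen_orthogonal_null]). The space W of vectors orthogonal to all
    eigenvectors is stable under K. Suppose that W is nonzero, and let M > 0 be
    the norm of K on W. As G is symmetric, |K h|^2 <= |K K h| |h|
    ([resolvent_snorm_sqr_le]). Applied to a maximizing sequence h_n such that
    K h_n converges to u, this gives |K u| = M |u|: the norm is attained in W.
    Applied to u, it gives |K p'| = M |p'| for p' = K u as well. Now let
    p = K K u. Expanding a square shows that
    |(G - z) (G - conj z) p - M^-2 p| = 0, that is
    (A - t) (A + t) p = 0 with A = G - Re z and t^2 = M^-2 - (Im z)^2 >= 0. Hence
    either (A + t) p or p is an eigenvector lying in W, which is absurd.

    Coincidences are rare ([countable_coincidences]). If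
    nu1 i + s^alpha nu2 j = nu1 i' + s^alpha nu2 j' with (i, j) <> (i', j'), then
    j <> j', so the equation determines s^alpha and hence s. The exceptional set
    is therefore covered by countably many sets with at most one element. *)

Set Implicit Arguments.
Unset Strict Implicit.
Unset Printing Implicit Defensive.

Import Order.TTheory GRing.Theory Num.Theory.
Import numFieldTopology.Exports numFieldNormedType.Exports.

Local Open Scope classical_set_scope.
Local Open Scope ring_scope.
Local Open Scope complex_scope.

(** * Pre-Hilbert spaces *)

Section ConjC.
Context {R : realType}.
Implicit Types x y : R[i].

Lemma conjcD x y : conjc (x + y) = conjc x + conjc y.
Proof. exact: rmorphD. Qed.

Lemma conjcB x y : conjc (x - y) = conjc x - conjc y.
Proof. exact: rmorphB. Qed.

Lemma conjcM x y : conjc (x * y) = conjc x * conjc y.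
Proof. exact: rmorphM. Qed.

Lemma conjc_sum (I : Type) (r : seq I) (P : pred I) (F : I -> R[i]) :
  conjc (\sum_(i <- r | P i) F i) = \sum_(i <- r | P i) conjc (F i).
Proof. exact: rmorph_sum. Qed.

Lemma realCM (a b : R) : (a * b)%:C = a%:C * b%:C.
Proof. exact: (rmorphM (real_complex R)). Qed.

End ConjC.

(** Vectors of norm 0 are not identified with 0, and the inner product behaves
    well on the subspace H only: square-integrable functions are handled as
    functions, not as classes of functions. *)
Record semi_inner (R : realType) (V : lmodType R[i]) (H : set V)
    (dot : V -> V -> R[i]) : Prop := SemiInner {
  si0 : H 0;
  siL : forall a f g, H f -> H g -> H (a *: f + g);
  si_dotL : forall a f g h, H f -> H g -> H h ->
    dot (a *: f + g) h = a * dot f h + dot g h;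
  si_dotC : forall f g, dot g f = conjc (dot f g);
  si_ge0 : forall f, H f -> 0 <= complex.Re (dot f f) }.

Section SemiInner.
Context {R : realType} {V : lmodType R[i]} {H : set V}.
Context {dot : V -> V -> R[i]}.
Hypothesis ip : semi_inner H dot.

Definition snorm f := Num.sqrt (complex.Re (dot f f)).
Local Notation N := snorm.

Lemma siD f g : H f -> H g -> H (f + g).
Proof. by move=> Hf Hg; rewrite -[f]scale1r; exact: (siL ip). Qed.

Lemma siZ a f : H f -> H (a *: f).
Proof. by move=> Hf; rewrite -[_ *: _]addr0; apply: (siL ip) => //; exact: si0 ip. Qed.

Lemma siN f : H f -> H (- f).
Proof. by rewrite -scaleN1r; exact: siZ. Qed.

Lemma siB f g : H f -> H g -> H (f - g).
Proof. by move=> Hf Hg; apply: siD => //; exact: siN. Qed.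

Lemma si_sum (I : Type) (r : seq I) (P : pred I) (F : I -> V) :
  (forall i, P i -> H (F i)) -> H (\sum_(i <- r | P i) F i).
Proof. by move=> HF; apply: (big_ind H) => //; [exact: si0 ip|exact: siD]. Qed.

Lemma dot0l h : H h -> dot 0 h = 0.
Proof.
move=> Hh; have := si_dotL ip 1 (si0 ip) (si0 ip) Hh.
rewrite scaler0 addr0 mul1r => /eqP.
by rewrite -subr_eq0 opprD addrA subrr add0r oppr_eq0 => /eqP.
Qed.

Lemma dotDl f g h : H f -> H g -> H h -> dot (f + g) h = dot f h + dot g h.
Proof. by move=> Hf Hg Hh; rewrite -[f]scale1r (si_dotL ip)// scale1r mul1r. Qed.

Lemma dotZl a f h : H f -> H h -> dot (a *: f) h = a * dot f h.
Proof.
move=> Hf Hh; have := si_dotL ip a Hf (si0 ip) Hh.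
by rewrite !addr0 dot0l// addr0.
Qed.

Lemma dotBl f g h : H f -> H g -> H h -> dot (f - g) h = dot f h - dot g h.
Proof.
move=> Hf Hg Hh; rewrite dotDl//; last exact: siN.
by rewrite -scaleN1r dotZl// mulN1r.
Qed.

Lemma dotDr f g h : H f -> H g -> H h -> dot h (f + g) = dot h f + dot h g.
Proof. by move=> Hf Hg Hh; rewrite (si_dotC ip) dotDl// conjcD -!(si_dotC ip). Qed.

Lemma dotZr a f h : H f -> H h -> dot h (a *: f) = conjc a * dot h f.
Proof. by move=> Hf Hh; rewrite (si_dotC ip) dotZl// conjcM -(si_dotC ip). Qed.

Lemma dotBr f g h : H f -> H g -> H h -> dot h (f - g) = dot h f - dot h g.
Proof. by move=> Hf Hg Hh; rewrite (si_dotC ip) dotBl// conjcB -!(si_dotC ip). Qed.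

Lemma dot_suml (I : Type) (r : seq I) (P : pred I) (a : I -> R[i]) (F : I -> V) h :
  (forall i, H (F i)) -> H h ->
  dot (\sum_(i <- r | P i) a i *: F i) h = \sum_(i <- r | P i) a i * dot (F i) h.
Proof.
move=> HF Hh; elim: r => [|i r IH]; first by rewrite !big_nil dot0l.
rewrite !big_cons; case: ifP => // Pi; rewrite (si_dotL ip) ?IH//.
by apply: si_sum => j _; exact: siZ.
Qed.

Lemma dot_sumr (I : Type) (r : seq I) (P : pred I) (a : I -> R[i]) (F : I -> V) h :
  (forall i, H (F i)) -> H h ->
  dot h (\sum_(i <- r | P i) a i *: F i) =
    \sum_(i <- r | P i) conjc (a i) * dot h (F i).
Proof.
move=> HF Hh; rewrite (si_dotC ip) dot_suml// conjc_sum.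
by apply: eq_bigr => i _; rewrite conjcM -(si_dotC ip).
Qed.

Lemma snorm_ge0 f : 0 <= N f.
Proof. exact: sqrtr_ge0. Qed.

Lemma dotE f : H f -> dot f f = (N f ^+ 2)%:C.
Proof.
move=> Hf; rewrite sqr_sqrtr ?(si_ge0 ip)//.
have := si_dotC ip f f; case: (dot f f) => a b [] /= /eqP.
by rewrite -subr_eq0 opprK -mulr2n mulrn_eq0 /= => /eqP ->.
Qed.

Lemma Re_dot f : H f -> complex.Re (dot f f) = N f ^+ 2.
Proof. by move=> /dotE ->. Qed.

Lemma snormZ a f : H f ->
  N (a *: f) ^+ 2 = (complex.Re a ^+ 2 + complex.Im a ^+ 2) * N f ^+ 2.
Proof.
move=> Hf; have Haf : H (a *: f) by exact: siZ.
apply: (@complexI R); rewrite -dotE// dotZl// dotZr// dotE// [RHS]realCM.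
by rewrite add_Re2_Im2 sqr_normc mulrA.
Qed.

Lemma snormZE a f : H f ->
  N (a *: f) = Num.sqrt (complex.Re a ^+ 2 + complex.Im a ^+ 2) * N f.
Proof.
move=> Hf; apply/eqP; rewrite -(@eqrXn2 _ 2) ?mulr_ge0 ?sqrtr_ge0 ?snorm_ge0//.
apply/eqP; rewrite snormZ// exprMn; congr (_ * _).
by rewrite sqr_sqrtr ?addr_ge0 ?sqr_ge0.
Qed.

Lemma snormZr (a : R) f : 0 <= a -> H f -> N (a%:C *: f) = a * N f.
Proof.
move=> a0 Hf; apply/eqP; rewrite -(@eqrXn2 _ 2)//.
- by rewrite snormZ//= exprMn expr0n addr0.
- exact: snorm_ge0.
- by rewrite mulr_ge0// snorm_ge0.
Qed.

Lemma snormN f : H f -> N (- f) = N f.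
Proof.
move=> Hf; apply/eqP; rewrite -(@eqrXn2 _ 2) ?snorm_ge0//.
by rewrite -scaleN1r snormZ//= oppr0 expr0n addr0 sqrrN expr1n mul1r.
Qed.

Lemma snorm0 : N 0 = 0.
Proof. by rewrite /N dot0l ?sqrtr0//; exact: si0 ip. Qed.

Lemma snormD2 f g : H f -> H g ->
  N (f + g) ^+ 2 = N f ^+ 2 + 2 * complex.Re (dot f g) + N g ^+ 2.
Proof.
move=> Hf Hg; rewrite -Re_dot; last exact: siD.
rewrite dotDl ?dotDr//; try exact: siD.
rewrite (si_dotC ip f g) !dotE//.
by case: (dot f g) => a b /=; ring.
Qed.

Lemma snormB2 f g : H f -> H g ->
  N (f - g) ^+ 2 = N f ^+ 2 - 2 * complex.Re (dot f g) + N g ^+ 2.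
Proof.
move=> Hf Hg; rewrite snormD2 ?snormN//; last exact: siN.
rewrite -scaleN1r dotZr//; case: (dot f g) => a b /=; ring.
Qed.

Lemma Re_dot_le f g : H f -> H g -> complex.Re (dot f g) <= N f * N g.
Proof.
move=> Hf Hg.
(* positivity of |a f - b g|^2 *)
have key (a b : R) : 0 <= a -> 0 <= b ->
    0 <= a ^+ 2 * N f ^+ 2 - 2 * (a * b) * complex.Re (dot f g) + b ^+ 2 * N g ^+ 2.
  move=> a0 b0; have := sqr_ge0 (N (a%:C *: f - b%:C *: g)).
  rewrite snormB2; try exact: siZ.
  rewrite !snormZr// dotZl ?dotZr//; try exact: siZ.
  by case: (dot f g) => x y /=; rewrite !exprMn; congr (_ <= _); ring.
set r := complex.Re _ in key *.
have := snorm_ge0 f; have := snorm_ge0 g.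
rewrite le_eqVlt => /orP[/eqP g0|g0]; rewrite le_eqVlt => /orP[/eqP f0|f0].
- have := key 1 1 ler01 ler01; rewrite -f0 -g0; lra.
- rewrite leNgt; apply/negP => rpos.
  have b0 : 0 <= (N f ^+ 2 + 1) / r.
    rewrite divr_ge0 ?addr_ge0 ?sqr_ge0// ltW//.
    by rewrite (le_lt_trans _ rpos)// -g0 mulr0.
  have := key 1 _ ler01 b0; rewrite -g0 mul1r mulr0 in rpos *.
  rewrite -mulrA divfK ?gt_eqF// expr0n expr1n /=; have := sqr_ge0 (N f); lra.
- rewrite leNgt; apply/negP => rpos.
  have b0 : 0 <= (N g ^+ 2 + 1) / r.
    rewrite divr_ge0 ?addr_ge0 ?sqr_ge0// ltW//.
    by rewrite (le_lt_trans _ rpos)// -f0 mul0r.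
  have := key _ 1 b0 ler01; rewrite -f0 mul0r mulr1 in rpos *.
  rewrite -mulrA divfK ?gt_eqF// expr0n expr1n /=; have := sqr_ge0 (N g); lra.
- have := key _ _ (snorm_ge0 g) (snorm_ge0 f).
  have p : 0 < N f * N g by rewrite mulr_gt0.
  have -> : N g ^+ 2 * N f ^+ 2 - 2 * (N g * N f) * r + N f ^+ 2 * N g ^+ 2
    = 2 * ((N f * N g) * (N f * N g - r)) by ring.
  by rewrite pmulr_rge0// pmulr_rge0// subr_ge0.
Qed.

Lemma CauchySchwarz f g : H f -> H g -> `|dot f g| <= (N f * N g)%:C.
Proof.
move=> Hf Hg; set d := dot f g.
have [->|d0] := eqVneq d 0; first by rewrite normr0 ler0c mulr_ge0 ?snorm_ge0.
pose n := complex.Re `|d|; have nE : `|d| = n%:C by rewrite /n normc_def.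
have n0 : 0 < n by rewrite -ltcR -nE normr_gt0.
(* rotate f so that its inner product with g becomes |d| *)
have := @Re_dot_le (conjc d / n%:C *: f) g (siZ _ Hf) Hg.
have -> : N (conjc d / n%:C *: f) = N f.
  apply/eqP; rewrite -(@eqrXn2 _ 2) ?snorm_ge0// snormZ//.
  rewrite [X in X * _](_ : _ = 1) ?mul1r//; apply: (@complexI R).
  rewrite add_Re2_Im2 normf_div normcJ nE normc_def /= expr0n addr0 sqrtr_sqr.
  by rewrite gtr0_norm// divff// -?nE ?normr_eq0// expr1n.
have -> : dot (conjc d / n%:C *: f) g = n%:C.
  rewrite dotZl// -/d mulrAC [conjc d * d]mulrC -sqr_normc nE expr2 mulfK//.
  by rewrite -nE normr_eq0.
by rewrite nE lecR.
Qed.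

Lemma dot_null f g : H f -> H g -> N g = 0 -> dot f g = 0.
Proof.
move=> Hf Hg g0; have := CauchySchwarz Hf Hg; rewrite g0 mulr0.
by rewrite normr_le0 => /eqP.
Qed.

Lemma snormD f g : H f -> H g -> N (f + g) <= N f + N g.
Proof.
move=> Hf Hg; rewrite -(@ler_pXn2r _ 2)// ?nnegrE ?addr_ge0 ?snorm_ge0//.
rewrite snormD2//; have := Re_dot_le Hf Hg.
have -> : (N f + N g) ^+ 2 = N f ^+ 2 + 2 * (N f * N g) + N g ^+ 2 by ring.
lra.
Qed.

Lemma snormBC f g : H f -> H g -> N (f - g) = N (g - f).
Proof. by move=> Hf Hg; rewrite -opprB snormN//; exact: siB. Qed.

Lemma snorm_leD f g : H f -> H g -> N f <= N g + N (f - g).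
Proof.
move=> Hf Hg; rewrite -{1}[f](subrK g) addrC.
by apply: snormD => //; exact: siB.
Qed.

Lemma dot_eqr f g h : H f -> H g -> H h -> N (f - g) = 0 -> dot h f = dot h g.
Proof.
move=> Hf Hg Hh fg; apply/eqP; rewrite -subr_eq0 -dotBr//.
by rewrite dot_null//; exact: siB.
Qed.

(** For passing to the limit in an orthogonality relation. *)
Lemma dot_small0 d g : H g ->
  (forall e : R, 0 < e -> exists x, [/\ H x, N x < e & dot x g = d]) -> d = 0.
Proof.
move=> Hg small; apply: contrapT => /eqP d0.
pose n := complex.Re `|d|; have nE : `|d| = n%:C by rewrite /n normc_def.
have n0 : 0 < n by rewrite -ltcR -nE normr_gt0.
have g1 : 0 < N g + 1 by rewrite ltr_wpDl ?snorm_ge0.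
have [x [Hx xe xd]] := small (n / (N g + 1)) (divr_gt0 n0 g1).
have := CauchySchwarz Hx Hg; rewrite xd nE lecR; apply/negP; rewrite -ltNge.
rewrite (le_lt_trans (ler_wpM2r (snorm_ge0 _) (ltW xe)))//.
by rewrite mulrAC ltr_pdivrMr// ltr_pM2l// ltrDl.
Qed.

(** A row vector v in the kernel of the Gram matrix gives a combination
    of the e k of norm 0. *)
Lemma Gram_unit m (e : 'I_m -> V) : (forall k, H (e k)) ->
  (forall a : 'I_m -> R[i], N (\sum_k a k *: e k) = 0 -> forall k, a k = 0) ->
  (\matrix_(k, l) dot (e k) (e l)) \in unitmx.
Proof.
move=> He free; rewrite -row_free_unit -kermx_eq0; apply/eqP/row_matrixP => j.
rewrite row0; set A := matrix_of_fun _ _.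
have : row j (kermx A) *m A = 0 by apply/sub_kermxP; exact: row_sub.
move: (row j _) => v vA.
suff v0 k : v 0 k = 0 by apply/rowP => k; rewrite v0 mxE.
apply: (free (fun k => v 0 k)); rewrite /N dot_sumr//; last first.
  by apply: si_sum => ? _; exact: siZ.
rewrite big1 ?sqrtr0// => l _; rewrite dot_suml//.
have /rowP/(_ l) := vA; rewrite !mxE => vAl.
rewrite [X in _ * X](_ : _ = 0) ?mulr0// -[RHS]vAl.
by apply: eq_bigr => i _; rewrite mxE.
Qed.

End SemiInner.
Arguments snorm {R V} dot f.
(** * Completeness of the eigenvectors of an operator with compact resolvent *)

(** Operators are graphs, compatible with equality up to vectors of norm 0. *)
Record symmetric_operator (R : realType) (V : lmodType R[i]) (H : set V)
    (dot : V -> V -> R[i]) (G : V -> V -> Prop) : Prop := SymmetricOperator {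
  so_dom : forall f g, G f g -> H f /\ H g;
  so0 : G 0 0;
  soL : forall a f f' g g', G f g -> G f' g' -> G (a *: f + f') (a *: g + g');
  so_null : forall f g, G f g -> snorm dot f = 0 -> snorm dot g = 0;
  so_eqr : forall f g g', G f g -> H g' -> snorm dot (g - g') = 0 -> G f g';
  so_sym : forall f g f' g', G f g -> G f' g' -> dot g f' = dot f g' }.

Section SymmetricOperator.
Context {R : realType} {V : lmodType R[i]} {H : set V}.
Context {dot : V -> V -> R[i]} {G : V -> V -> Prop}.
Hypotheses (ip : semi_inner H dot) (so : symmetric_operator H dot G).
Local Notation N := (snorm dot).

Lemma so_doml f g : G f g -> H f. Proof. by move=> /(so_dom so)[]. Qed.
Lemma so_domr f g : G f g -> H g. Proof. by move=> /(so_dom so)[]. Qed.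

Lemma soZ a f g : G f g -> G (a *: f) (a *: g).
Proof. by move=> fg; have := soL so a fg (so0 so); rewrite !addr0. Qed.

Lemma soD f f' g g' : G f g -> G f' g' -> G (f + f') (g + g').
Proof. by move=> fg fg'; have := soL so 1 fg fg'; rewrite !scale1r. Qed.

Lemma soB f f' g g' : G f g -> G f' g' -> G (f - f') (g - g').
Proof.
move=> fg fg'; apply: soD => //.
by rewrite -(scaleN1r f') -(scaleN1r g'); exact: soZ.
Qed.

Lemma Im_dot_diag f g : G f g -> complex.Im (dot g f) = 0.
Proof.
move=> fg; have := so_sym so fg fg; rewrite {1}(si_dotC ip).
by case: (dot f g) (si_dotC ip f g) => a b -> [] /=; lra.
Qed.

Lemma eigen_orth z z' f g : G f (z *: f) -> G g (z' *: g) -> z != conjc z' ->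
  dot f g = 0.
Proof.
move=> ef eg zz'; have Hf := so_doml ef; have Hg := so_doml eg.
have := so_sym so ef eg; rewrite (dotZl ip)// (dotZr ip)// => /eqP.
by rewrite -subr_eq0 -mulrBl mulf_eq0 subr_eq0 (negPf zz') => /eqP.
Qed.

Lemma eigen_real z f : G f (z *: f) -> N f != 0 -> z = conjc z.
Proof.
move=> ef f0; apply: contra_neqP f0 => zz.
have := eigen_orth ef ef; rewrite /snorm => -> //; last exact/eqP.
by rewrite sqrtr0.
Qed.

(** The relation (G - z) f = h is written [G f (h + z *: f)]; when it determines
    f, it says that f is the image of h by the resolvent (G - z)^-1. *)
Section Resolvent.
Variable z : R[i].
Local Notation w := (z - conjc z).

(** |(G - conj z) f| = |(G - z) f|: as <G f, f> is real, both squares are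
    |(G - Re z) f|^2 + (Im z)^2 |f|^2. *)
Lemma Cayley_isometry h f : G f (h + z *: f) -> N (h + w *: f) = N h.
Proof.
move=> hf; have Hf := so_doml hf; have Hzf := siZ ip z Hf.
have Hh : H h.
  by rewrite -[h](addrK (z *: f)); apply: (siB ip) => //; exact: so_domr hf.
apply/eqP; rewrite -(@eqrXn2 _ 2) ?snorm_ge0//.
rewrite (snormD2 ip)//; last exact: (siZ ip).
rewrite (snormZ ip)// (dotZr ip)//.
have := Im_dot_diag hf; rewrite (dotDl ip)// (dotZl ip)// (dotE ip)//.
case: (dot h f) => x y; case: z => a b /= hxy.
apply/eqP; have -> : y = - (b * N f ^+ 2) by move: hxy; lra.
ring.
Qed.

(** |K h|^2 <= |K K h| |h| for K = (G - z)^-1: with f = K h and q = K f one has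
    |f|^2 = <(G - z) q, f> = <q, (G - conj z) f>, and |(G - conj z) f| = |h|. *)
Lemma resolvent_snorm_sqr_le q f h : G q (f + z *: q) -> G f (h + z *: f) ->
  N f ^+ 2 <= N q * N h.
Proof.
move=> fq hf; have Hf := so_doml hf; have Hq := so_doml fq.
have Hzf := siZ ip z Hf; have Hzq := siZ ip z Hq.
have Hh : H h.
  by rewrite -[h](addrK (z *: f)); apply: (siB ip) => //; exact: so_domr hf.
rewrite -(Cayley_isometry hf) -(Re_dot ip)//.
have -> : dot f f = dot q (h + w *: f).
  have := so_sym so fq hf; rewrite (dotDl ip)// (dotZl ip)// (dotDr ip)// (dotZr ip)//.
  move=> e; rewrite (dotDr ip) ?(dotZr ip)//; last exact: (siZ ip).
  by rewrite conjcB conjcK mulrBl addrA -e; ring.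
by apply: (Re_dot_le ip) => //; apply: (siD ip) => //; exact: (siZ ip).
Qed.

End Resolvent.
Section CompactResolvent.
Variables (z : R[i]) (C : R).
Hypothesis surj : forall h, H h -> exists f, G f (h + z *: f).
Hypothesis bnd : forall h f, H h -> G f (h + z *: f) -> N f <= C * N h.
Hypothesis cpt : forall h f : nat -> V,
  (forall k, H (h k) /\ G (f k) (h k + z *: f k)) ->
  (exists B : R, forall k, N (h k) <= B) ->
  exists (sigma : nat -> nat) (u : V),
    [/\ {homo sigma : i j / (i < j)%N}, H u &
        N (f (sigma k) - u) @[k --> \oo] --> (0 : R)].
Local Notation w := (z - conjc z).

Definition eigen_orthogonal h :=
  H h /\ forall z' f, G f (z' *: f) -> dot h f = 0.
Local Notation W := eigen_orthogonal.

Lemma eigen_orthogonalH h : W h -> H h. Proof. by case. Qed.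

Lemma eigen_orthogonalL a f g : W f -> W g -> W (a *: f + g).
Proof.
move=> [Hf Wf] [Hg Wg]; split=> [|z' h eh]; first exact: (siL ip).
have Hh := so_doml eh.
by rewrite (si_dotL ip)// (Wf _ _ eh) (Wg _ _ eh) mulr0 addr0.
Qed.

Lemma eigen_orthogonalZ a f : W f -> W (a *: f).
Proof.
move=> [Hf Wf]; split=> [|z' h eh]; first exact: (siZ ip).
by rewrite (dotZl ip) ?(Wf _ _ eh) ?mulr0//; exact: so_doml eh.
Qed.

(** <h, g> = (z' - z) <f, g> for an eigenvector g, whose eigenvalue z' is real. If
    z' = z then g = (G - z)^-1 0 has norm 0. *)
Lemma resolvent_eigen_orthogonal h f : W h -> G f (h + z *: f) -> W f.
Proof.
move=> [Hh Wh] hf; have Hf := so_doml hf; split=> // z' g eg.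
have Hg := so_doml eg.
have [g0|g0] := eqVneq (N g) 0; first exact: (dot_null ip).
have zr := eigen_real eg g0.
have := so_sym so hf eg.
rewrite (dotDl ip) ?(dotZl ip)//; last exact: (siZ ip).
rewrite (Wh _ _ eg) add0r (dotZr ip)// -zr => /eqP.
rewrite -subr_eq0 -mulrBl mulf_eq0 subr_eq0 => /orP[/eqP zz'|/eqP//].
case/negP: g0; rewrite eq_le snorm_ge0 andbT.
have := @bnd 0 g (si0 ip); rewrite (snorm0 ip) mulr0; apply.
by rewrite add0r zz'.
Qed.

Lemma resolvent_null h f : H h -> G f (h + z *: f) -> N f = 0 -> N h = 0.
Proof.
move=> Hh hf f0; have Hf := so_doml hf; have Hzf := siZ ip z Hf.
apply/eqP; rewrite eq_le snorm_ge0 andbT.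
rewrite (le_trans (snorm_leD ip Hh (siD ip Hh Hzf)))//.
rewrite (so_null so hf f0) add0r opprD addrA subrr add0r (snormN ip)//.
by rewrite -(@ler_pXn2r _ 2) ?nnegrE ?snorm_ge0// (snormZ ip)// f0 expr0n mulr0.
Qed.

Definition resolvent_norms : set R :=
  [set r | exists h f, [/\ W h, N h <= 1, G f (h + z *: f) & r = N f]].
(* the norm of the resolvent on W *)
Local Notation M := (sup resolvent_norms).

Lemma has_sup_resolvent_norms : has_sup resolvent_norms.
Proof.
split.
  have G00 : G 0 (0 + z *: 0) by rewrite scaler0 addr0; exact: so0 so.
  exists (N 0), 0, 0; split=> //; last by rewrite (snorm0 ip).
  split=> [|z' f ef]; first exact: si0 ip.
  by rewrite (dot0l ip)//; exact: so_doml ef.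
exists `|C| => _ [h [f [[Hh _] h1 hf ->]]].
rewrite (le_trans (bnd Hh hf))// (le_trans (ler_wpM2r (snorm_ge0 _) (ler_norm C)))//.
by rewrite ler_piMr.
Qed.

Lemma resolvent_norm_le h f : W h -> G f (h + z *: f) -> N f <= M * N h.
Proof.
move=> Wh hf; have Hf := so_doml hf; have Hh := eigen_orthogonalH Wh.
have := @snorm_ge0 _ _ dot h; rewrite le_eqVlt => /orP[/eqP h0|h0].
  by have := bnd Hh hf; rewrite -h0 !mulr0.
rewrite -ler_pdivrMr// mulrC -(snormZr ip) ?invr_ge0 ?snorm_ge0//.
apply: (ub_le_sup (has_sup_resolvent_norms.2)).
exists ((N h)^-1%:C *: h), ((N h)^-1%:C *: f); split=> //.
- exact: eigen_orthogonalZ.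
- by rewrite (snormZr ip) ?invr_ge0 ?snorm_ge0// mulVf// gt_eqF.
- have := soZ (N h)^-1%:C hf.
  by rewrite scalerDr !scalerA mulrC.
Qed.

(** Images f_n = K h_n of a maximizing sequence accumulate at some u by
    compactness, so |u| <= M. Since M^2 = lim |f_n|^2 <= lim |K f_n| = |K u|
    by [resolvent_snorm_sqr_le], it follows that |K u| = M |u|. *)
Lemma resolvent_norm_attained h0 : W h0 -> N h0 != 0 ->
  0 < M /\ exists u, [/\ W u, 0 < N u &
    forall q, G q (u + z *: q) -> N q = M * N u].
Proof.
move=> Wh0 h00.
have Mpos : 0 < M.
  have [f0 hf0] := surj (eigen_orthogonalH Wh0).
  have f00 : 0 < N f0.
    rewrite lt_neqAle snorm_ge0 andbT eq_sym.
    by apply: contraNneq h00 => /(resolvent_null (eigen_orthogonalH Wh0) hf0)->.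
  have := lt_le_trans f00 (resolvent_norm_le Wh0 hf0).
  by rewrite pmulr_lgt0// lt_neqAle eq_sym h00 snorm_ge0.
split=> //.
have /choice[hf Hhf] : forall k : nat, exists p : V * V,
    [/\ W p.1, N p.1 <= 1, G p.2 (p.1 + z *: p.2) & M - k.+1%:R^-1 < N p.2].
  move=> k; have k0 : 0 < k.+1%:R^-1 :> R by rewrite invr_gt0.
  have [_ [h [f [Wh h1 hf ->]]] fM] := sup_adherent k0 has_sup_resolvent_norms.
  by exists (h, f).
have [k||sigma [u [incr Hu cvgu]]] := @cpt (fun k => (hf k).1) (fun k => (hf k).2).
- by have [/eigen_orthogonalH ? _ ? _] := Hhf k.
- by exists 1 => k; have [_ ? _ _] := Hhf k.
have sge k : (k <= sigma k)%N.
  by elim: k => // k IH; exact: leq_ltn_trans IH (incr _ _ (ltnSn k)).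
(* images of the maximizing sequence, as close to u as desired *)
have appr (e : R) : 0 < e -> exists h f,
    [/\ W h, N h <= 1, G f (h + z *: f), M - e < N f & N (f - u) < e].
  move=> e0.
  have /cvgrPdist_lt/(_ _ e0) near1 := cvgu.
  have /cvgrPdist_lt/(_ _ e0) near2 := @cvg_harmonic R.
  have [k [k1 k2]] : exists k,
      `|0 - N ((hf (sigma k)).2 - u)| < e /\ `|0 - harmonic k| < e.
    by near \oo => k; exists k; split; near: k.
  rewrite !sub0r !normrN !ger0_norm ?snorm_ge0 ?harmonic_ge0// in k1 k2.
  have [Wh h1 gf fM] := Hhf (sigma k).
  exists (hf (sigma k)).1, (hf (sigma k)).2; split=> //.
  apply: le_lt_trans fM; rewrite lerD2l lerN2.
  apply: le_trans (ltW k2); rewrite /harmonic lef_pV2 ?posrE// ler_nat ltnS.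
  exact: sge.
have [qu Hqu] := surj Hu.
have Hquu := so_doml Hqu.
have uM : N u <= M.
  apply/ler_addgt0Pr => e e0; have [h [f [Wh h1 gf _ fu]]] := appr _ e0.
  have Hf := so_doml gf.
  rewrite (le_trans (snorm_leD ip Hu Hf))// lerD//; last first.
    by rewrite (snormBC ip)// ltW.
  rewrite (le_trans (resolvent_norm_le Wh gf))// ler_piMr//; exact: ltW.
have Wu : W u.
  split=> // z' g eg; have Hg := so_doml eg.
  apply: (dot_small0 ip Hg) => e e0; have [h [f [Wh h1 gf _ fu]]] := appr _ e0.
  have [Hf Wf] := resolvent_eigen_orthogonal Wh gf.
  exists (u - f); split; [exact: (siB ip)|by rewrite (snormBC ip)|].
  by rewrite (dotBl ip)// (Wf _ _ eg) subr0.
have M2 q : G q (u + z *: q) -> M ^+ 2 <= N q.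
  move=> Hq; have Hqq := so_doml Hq; apply/ler_addgt0Pr => e e0.
  have K0 : 0 < 2 * M + `|C| + 1 by rewrite ltr_wpDl// addr_ge0// mulr_ge0// ltW.
  have d0 := divr_gt0 e0 K0; set d := e / _ in d0.
  have [h [f [Wh h1 gf fM fu]]] := appr _ d0.
  have Hf := so_doml gf; have [p gp] := surj Hf; have Hp := so_doml gp.
  have f2 : N f ^+ 2 <= N p.
    by rewrite (le_trans (resolvent_snorm_sqr_le gp gf))// ler_piMr// snorm_ge0.
  have pq : N (p - q) <= `|C| * d.
    have : G (p - q) ((f - u) + z *: (p - q)).
      by rewrite scalerBr addrACA -opprD; exact: soB.
    move/(bnd (siB ip Hf Hu))/le_trans; apply.
    rewrite (le_trans (ler_wpM2r (snorm_ge0 _) (ler_norm C)))//.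
    by rewrite ler_wpM2l// ltW.
  have pq' := snorm_leD ip Hp Hqq.
  have Kd : (2 * M + `|C| + 1) * d = e by rewrite mulrC divfK// gt_eqF.
  suff : M ^+ 2 - 2 * M * d <= N f ^+ 2 by move: Kd; rewrite !mulrDl mul1r; lra.
  have [dM|dM] := leP d M.
    rewrite (@le_trans _ _ ((M - d) ^+ 2))//; first by rewrite sqrrB; have := sqr_ge0 d; lra.
    by rewrite ler_pXn2r ?nnegrE ?snorm_ge0 ?subr_ge0// ltW.
  by rewrite (@le_trans _ _ 0) ?sqr_ge0//; nra.
have Mu : M <= N u.
  by rewrite -(ler_pM2l Mpos) -expr2 (le_trans (M2 _ Hqu))// resolvent_norm_le.
exists u; split=> // [|q Hq]; first exact: lt_le_trans Mpos Mu.
apply/eqP; rewrite eq_le resolvent_norm_le//= (le_trans _ (M2 _ Hq))//.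
by rewrite expr2 ler_pM2l.
Unshelve. all: by end_near.
Qed.
(** The vector p below satisfies (A - t) (A + t) p = 0 up to a vector of norm 0,
    where A = G - Re z; y stands for (A + t) p. *)
Theorem eigen_orthogonal_null h : W h -> N h = 0.
Proof.
move=> Wh; apply: contrapT => /eqP h0.
have [M0 [u [Wu u0 Nu]]] := resolvent_norm_attained Wh h0.
have Hu := eigen_orthogonalH Wu; have [q Gq] := surj Hu.
have Wq := resolvent_eigen_orthogonal Wu Gq.
have Hq := eigen_orthogonalH Wq; have [p Gp] := surj Hq.
have Wp := resolvent_eigen_orthogonal Wq Gp.
have Hp := eigen_orthogonalH Wp.
set s := N u in u0 Nu; set m := M in M0 Nu.
have Nq : N q = m * s by exact: Nu.
have Np : N p = m ^+ 2 * s.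
  apply/eqP; rewrite eq_le; apply/andP; split.
    by rewrite (le_trans (resolvent_norm_le Wq Gp))// Nq mulrA.
  by rewrite -(ler_pM2r u0) (le_trans _ (resolvent_snorm_sqr_le Gp Gq))// Nq !expr2; lra.
pose c : R := m ^- 2; pose a := complex.Re z; pose b := complex.Im z.
have zE : z = a%:C + b *i by rewrite /a /b; case: (z) => x y; simpc.
have qp : complex.Im (dot q p) = - (b * N p ^+ 2).
  have := Im_dot_diag Gp; rewrite (dotDl ip) ?(dotZl ip) ?(dotE ip)//; last exact: (siZ ip).
  by rewrite zE; case: (dot q p) => x y /=; lra.
(* |q|^2 - b^2 |p|^2 = |(G - a) p|^2 is nonnegative *)
have cb : b ^+ 2 <= c.
  have Hbp := siZ ip (b *i) Hp.
  have := sqr_ge0 (N (q + b *i *: p)); rewrite (snormD2 ip)// (snormZ ip)// (dotZr ip)//.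
  move: qp; case: (dot q p) => x y /= -> ge0.
  have : b ^+ 2 * N p ^+ 2 <= N q ^+ 2 by nra.
  rewrite Np Nq !exprMn mulrA (ler_pM2r (exprn_gt0 2 u0)).
  by rewrite mulrA -[leRHS]mul1r ler_pM2r ?exprn_gt0// -ler_pdivlMr ?exprn_gt0// mul1r.
(* r = (G - z) (G - conj z) p - c p *)
pose r := (u + w *: q) - c%:C *: p.
have Hwq := siZ ip w Hq; have Hcp := siZ ip c%:C Hp.
(* |r|^2 = |u|^2 - 2 c |q|^2 + c^2 |p|^2, with |q| = m |u| and |p| = m^2 |u| *)
have r0 : N r = 0.
  apply/eqP; rewrite -sqrf_eq0 (snormB2 ip)//; last exact: (siD ip).
  rewrite (Cayley_isometry Gq) (snormZr ip) ?invr_ge0 ?exprn_ge0 ?(ltW M0)//.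
  have -> : dot (u + w *: q) (c%:C *: p) = c%:C * (N q ^+ 2)%:C.
    rewrite (dotZr ip) ?(dotDl ip) ?(dotZl ip)//; last exact: (siD ip).
    rewrite conjc_real -(dotE ip)//; congr (_ * _).
    have := so_sym so Gq Gp.
    rewrite (dotDl ip) ?(dotZl ip) ?(dotDr ip) ?(dotZr ip)//; try exact: (siZ ip).
    by move=> e; rewrite mulrBl addrA e; ring.
  rewrite -realCM /= Nq Np /c -/s; apply/eqP; field.
  by rewrite gt_eqF.
pose t := Num.sqrt (c - b ^+ 2).
have t2 : t ^+ 2 = c - b ^+ 2 by rewrite sqr_sqrtr// subr_ge0.
(* y = (G - a + t) p, as G p = q + z p *)
pose kappa : R[i] := t%:C + b *i; pose y := q + kappa *: p.
have Wy : W y by rewrite /y addrC; exact: eigen_orthogonalL.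
have Gy : G y ((a + t)%:C *: y).
  apply: (so_eqr so (soD Gq (soZ kappa Gp))); first exact: (siZ ip _ (eigen_orthogonalH Wy)).
  rewrite [X in N X](_ : _ = r)// /r /y.
  have cE : - c%:C = kappa * z - (a + t)%:C * kappa.
    have -> : c = t ^+ 2 + b ^+ 2 by rewrite t2; ring.
    by rewrite /kappa zE; simpc; congr (_ +i* _); ring.
  have wE : w = z + kappa - (a + t)%:C.
    by rewrite /kappa zE; simpc; congr (_ +i* _); ring.
  rewrite -[in RHS]scaleNr cE wE !scalerDr !scalerA opprD [u + _ + _]addrA addrACA.
  rewrite [(z + kappa - _) *: q]scalerBl [(z + kappa) *: q]scalerDl.
  rewrite [(kappa * z - _) *: p]scalerBl.
  by rewrite !addrA.
(* y is an eigenvector in W *)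
have y0 : N y = 0 by rewrite /snorm (Wy.2 _ _ Gy) sqrtr0.
(* hence so is p, for the eigenvalue a - t *)
have Gp' : G p ((a - t)%:C *: p).
  apply: (so_eqr so Gp); first exact: (siZ ip).
  rewrite -[RHS]y0 /y /kappa zE -addrA -scalerBl; congr (N (_ + _ *: _)).
  by simpc; congr (_ +i* _); ring.
have : N p = 0 by rewrite /snorm (Wp.2 _ _ Gp') sqrtr0.
by apply/eqP; rewrite Np mulf_neq0 ?expf_neq0 ?gt_eqF.
Qed.
End CompactResolvent.
End SymmetricOperator.
(** * The space L^2 *)

Section ComplexIntegral.
Context d (T : measurableType d) (R : realType).
Variable mu : {measure set T -> \bar R}.
Implicit Types F G f g : T -> R[i].

Definition cintegrable F :=
  mu.-integrable setT (EFin \o (fun x => complex.Re (F x))) /\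
  mu.-integrable setT (EFin \o (fun x => complex.Im (F x))).

Definition cint F : R[i] :=
  (\int[mu]_x complex.Re (F x)) +i* (\int[mu]_x complex.Im (F x)).

Lemma integrable_lin (a b : R) (u v : T -> R) :
  mu.-integrable setT (EFin \o u) -> mu.-integrable setT (EFin \o v) ->
  mu.-integrable setT (EFin \o (fun x => a * u x + b * v x)).
Proof.
move=> iu iv.
rewrite (_ : _ \o _ =
  (fun x => a%:E * (u x)%:E) \+ (fun x => b%:E * (v x)%:E))%E//.
by apply: integrableD => //; exact: integrableZl.
Qed.

Lemma Rintegral_lin (a b : R) (u v : T -> R) :
  mu.-integrable setT (EFin \o u) -> mu.-integrable setT (EFin \o v) ->
  (\int[mu]_x (a * u x + b * v x) =
   a * (\int[mu]_x u x) + b * (\int[mu]_x v x))%R.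
Proof.
move=> iu iv; rewrite RintegralD ?RintegralZl//.
  exact: (integrableZl _ a iu).
exact: (integrableZl _ b iv).
Qed.

Lemma cintegrableL a F G : cintegrable F -> cintegrable G ->
  cintegrable (fun x => a * F x + G x).
Proof.
case: a => a b [rF iF] [rG iG]; split.
  rewrite (_ : _ \o _ = EFin \o (fun x =>
      1 * (a * complex.Re (F x) + (- b) * complex.Im (F x)) +
      1 * complex.Re (G x))).
    by apply: integrable_lin => //; exact: integrable_lin.
  by apply/funext => x /=; case: (F x) (G x) => ? ? [? ?] /=; congr EFin; ring.
rewrite (_ : _ \o _ = EFin \o (fun x =>
    1 * (a * complex.Im (F x) + b * complex.Re (F x)) +
    1 * complex.Im (G x))).
  by apply: integrable_lin => //; exact: integrable_lin.
by apply/funext => x /=; case: (F x) (G x) => ? ? [? ?] /=; congr EFin; ring.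
Qed.

Lemma cintL a F G : cintegrable F -> cintegrable G ->
  cint (fun x => a * F x + G x) = a * cint F + cint G.
Proof.
case: a => a b [rF iF] [rG iG]; rewrite /cint.
rewrite (_ : (fun x => complex.Re _) = (fun x =>
    1 * (a * complex.Re (F x) + (- b) * complex.Im (F x)) +
    1 * complex.Re (G x))); last first.
  by apply/funext => x /=; case: (F x) (G x) => ? ? [? ?] /=; ring.
rewrite (_ : (fun x => complex.Im _) = (fun x =>
    1 * (a * complex.Im (F x) + b * complex.Re (F x)) +
    1 * complex.Im (G x))); last first.
  by apply/funext => x /=; case: (F x) (G x) => ? ? [? ?] /=; ring.
rewrite !Rintegral_lin//; try exact: integrable_lin.
by simpc; congr (_ +i* _); ring.
Qed.

Lemma cintZ a F : cintegrable F -> cint (fun x => a * F x) = a * cint F.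
Proof.
move=> iF; rewrite -[in RHS](subrK 1 a) mulrDl mul1r -cintL//.
by congr cint; apply/funext => x /=; ring.
Qed.

Lemma ae_eq_cint F G : cintegrable F -> cintegrable G -> aeq mu F G ->
  cint F = cint G.
Proof.
move=> [rF iF] [rG iG] FG; rewrite /cint /Rintegral.
congr (fine _ +i* fine _).
  apply: ae_eq_integral => //; first exact: measurable_int rF.
    exact: measurable_int rG.
  by apply: filterS FG => x /= ->.
apply: ae_eq_integral => //; first exact: measurable_int iF.
  exact: measurable_int iG.
by apply: filterS FG => x /= ->.
Qed.

(** True for every u: both sides are 0 when the integral of u is infinite. *)
Lemma RintegralN (u : T -> R) : (\int[mu]_x (- u x) = - \int[mu]_x u x)%R.
Proof.
rewrite /Rintegral.
have -> : (fun x => (- u x)%:E) = (fun x => - (u x)%:E)%E by [].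
rewrite integralE [in RHS]integralE funeposN funenegN.
have := @integral_ge0 _ _ _ mu setT _ (fun x _ => funepos_ge0 (EFin \o u) x).
have := @integral_ge0 _ _ _ mu setT _ (fun x _ => funeneg_ge0 (EFin \o u) x).
by case: integral => [a||]; case: integral => [b||] //= _ _; rewrite ?opprB ?oppr0.
Qed.

Lemma cint_conj F : cint (fun x => conjc (F x)) = conjc (cint F).
Proof.
rewrite /cint /= -RintegralN.
by congr (_ +i* _); congr Rintegral; apply/funext => x; case: (F x).
Qed.

End ComplexIntegral.
Section L2Space.
Context d (T : measurableType d) (R : realType).
Variable mu : {measure set T -> \bar R}.
Implicit Types f g h : T -> R[i].

Lemma Lfun2P (u : T -> R) : u \in Lfun mu 2%:E <->
  measurable_fun setT u /\ mu.-integrable setT (EFin \o (fun x => u x ^+ 2)).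
Proof.
split=> [u2|[mu_ iu]].
  by split; [move: u2; rewrite inE => /andP[]; rewrite inE|exact: Lfun2_integrable_sqr].
rewrite inE; apply/andP; split; rewrite inE//= /finite_norm unlock /Lnorm.
rewrite poweR_lty//; case/integrableP : iu => _; apply: le_lt_trans.
rewrite le_eqVlt; apply/orP; left; apply/eqP; apply: eq_integral => x _ /=.
by rewrite powR_mulrn// normrX.
Qed.

Definition sqmod (z : R[i]) : R := complex.Re z ^+ 2 + complex.Im z ^+ 2.

Lemma sqmod_ge0 z : 0 <= sqmod z.
Proof. by rewrite addr_ge0 ?sqr_ge0. Qed.

Lemma sqmodM z z' : sqmod (z * z') = sqmod z * sqmod z'.
Proof. by case: z z' => a b [c e]; rewrite /sqmod /=; ring. Qed.

Lemma sqmod_eq0 z : sqmod z = 0 -> z = 0.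
Proof.
case: z => a b; rewrite /sqmod /= => /eqP.
by rewrite paddr_eq0 ?sqr_ge0// !sqrf_eq0 => /andP[/eqP-> /eqP->].
Qed.

Definition cmeasurable f := measurable_fun setT (fun x => complex.Re (f x)) /\
  measurable_fun setT (fun x => complex.Im (f x)).

Lemma measurable_sqmod f : cmeasurable f -> measurable_fun setT (fun x => sqmod (f x)).
Proof. by move=> [rf jf]; apply: measurable_funD; exact: measurable_funX. Qed.

Lemma L2P f : L2 mu f <->
  cmeasurable f /\ mu.-integrable setT (EFin \o (fun x => sqmod (f x))).
Proof.
split=> [[/Lfun2P[rf irf] /Lfun2P[jf ijf]]|[[rf jf] sf]].
  by split=> //; exact: (integrableD _ irf ijf).
split; apply/Lfun2P; split=> //; apply: le_integrable sf => //.
- by apply/measurable_EFinP; exact: measurable_funX.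
- move=> x _; rewrite lee_fin !ger0_norm ?sqr_ge0 ?sqmod_ge0//.
  by rewrite lerDl sqr_ge0.
- by apply/measurable_EFinP; exact: measurable_funX.
- move=> x _; rewrite lee_fin !ger0_norm ?sqr_ge0 ?sqmod_ge0//.
  by rewrite lerDr sqr_ge0.
Qed.

Lemma L2_0 : L2 mu (fun=> 0).
Proof.
apply/L2P; split; first by split.
rewrite (_ : _ \o _ = cst 0%E); first exact: integrable0.
by apply/funext => x; rewrite /sqmod /= expr0n addr0.
Qed.

Lemma L2_conjM_cintegrable f g : L2 mu f -> L2 mu g ->
  cintegrable mu (fun x => f x * conjc (g x)).
Proof.
move=> [rf jf] [rg jg].
have I (u v : T -> R) : u \in Lfun mu 2%:E -> v \in Lfun mu 2%:E ->
    mu.-integrable setT (EFin \o (fun x => u x * v x)).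
  by move=> u2 v2; apply/Lfun1_integrable; exact: Lfun2_mul_Lfun1.
have := integrable_lin 1 1 (I _ _ rf rg) (I _ _ jf jg).
have := integrable_lin 1 (-1) (I _ _ jf rg) (I _ _ rf jg).
move=> i1 i2; split; [move: i2|move: i1]; congr (_ .-integrable _ _);
  by apply/funext => x /=; case: (f x) (g x) => ? ? [? ?] /=; congr EFin; ring.
Qed.

Lemma dotL2E f g : dotL2 mu f g = cint mu (fun x => f x * conjc (g x)).
Proof. by []. Qed.

Lemma L2L (a : R[i]) f g : L2 mu f -> L2 mu g -> L2 mu (a *: f + g).
Proof.
have l1 : (1 <= 2%:E :> \bar R)%E by rewrite lee_fin ler1n.
have D (u v : T -> R) (b c : R) : u \in Lfun mu 2%:E -> v \in Lfun mu 2%:E ->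
    (fun x => b * u x + c * v x) \in Lfun mu 2%:E.
  move=> u2 v2; have [_] := Lfun_addr_closed mu l1; apply.
    have -> : (fun x => b * u x) = (b \o* u) by apply/funext => x /=; rewrite mulrC.
    by apply: Lfun_scale => //; rewrite ler1n.
  have -> : (fun x => c * v x) = (c \o* v) by apply/funext => x /=; rewrite mulrC.
  by apply: Lfun_scale => //; rewrite ler1n.
case: a => a b [rf jf] [rg jg]; split.
  rewrite (_ : (fun x => _) = fun x =>
      1 * (a * complex.Re (f x) + - b * complex.Im (f x)) +
      1 * complex.Re (g x)).
    by apply: (D) => //; exact: D.
  by apply/funext => x /=; rewrite !fctE; case: (f x) (g x) => ? ? [? ?] /=; ring.
rewrite (_ : (fun x => _) = fun x =>
    1 * (a * complex.Im (f x) + b * complex.Re (f x)) +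
    1 * complex.Im (g x)).
  by apply: (D) => //; exact: D.
by apply/funext => x /=; rewrite !fctE; case: (f x) (g x) => ? ? [? ?] /=; ring.
Qed.

Lemma L2_semi_inner : semi_inner (L2 mu) (dotL2 mu).
Proof.
split.
- exact: L2_0.
- exact: L2L.
- move=> a f g h f2 g2 h2; rewrite !dotL2E -cintL; try exact: L2_conjM_cintegrable.
  congr cint; apply/funext => x; rewrite mulrDl mulrA//.
- move=> f g; rewrite !dotL2E -cint_conj; congr cint; apply/funext => x.
  by rewrite conjcM conjcK mulrC.
- move=> f _; apply: Rintegral_ge0 => x _; case: (f x) => a b /=.
  by rewrite mulrN opprK addr_ge0// -expr2 sqr_ge0.
Qed.

Lemma normL2_sqr f : normL2 mu f ^+ 2 = (\int[mu]_x sqmod (f x))%R.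
Proof.
rewrite /normL2 sqr_sqrtr; last first.
  apply: Rintegral_ge0 => x _; case: (f x) => a b /=.
  by rewrite mulrN opprK addr_ge0// -expr2 sqr_ge0.
congr Rintegral; apply/funext => x; rewrite /sqmod; case: (f x) => a b /=; ring.
Qed.

Lemma normL2_eq0 f : L2 mu f -> normL2 mu f = 0 <-> aeq mu f (fun=> 0).
Proof.
move=> /L2P[mf sf]; split.
  move=> f0; have I0 : (\int[mu]_x (sqmod (f x))%:E = 0)%E.
    rewrite -[LHS]fineK; last exact: integrable_fin_num sf.
    by have := normL2_sqr f; rewrite f0 expr0n /= /Rintegral => <-.
  have msf : measurable_fun setT (EFin \o (fun x => sqmod (f x))).
    by apply/measurable_EFinP; exact: measurable_sqmod.
  have [ae0 _] := ae_eq_integral_abs mu measurableT msf.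
  apply: filterS (ae0 _) => [x /= /(_ I)[] /sqmod_eq0//|].
  rewrite -[RHS]I0; apply: eq_integral => x _ /=.
  by rewrite ger0_norm ?sqmod_ge0.
move=> f0; apply/eqP; rewrite -sqrf_eq0 normL2_sqr /Rintegral.
rewrite (@ae_eq_integral _ _ _ mu setT (cst 0%E))//.
- by rewrite integral0.
- by apply/measurable_EFinP; exact: measurable_sqmod.
- by apply: filterS f0 => x -> _; rewrite /sqmod /= expr0n addr0.
Qed.

Lemma aeq_normL2 f g : L2 mu f -> L2 mu g ->
  aeq mu f g <-> normL2 mu (f - g) = 0.
Proof.
move=> f2 g2; rewrite normL2_eq0; last exact: (siB L2_semi_inner).
by split; apply: filterS => x; rewrite !fctE => /eqP; rewrite ?subr_eq0 => /eqP//;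
  move=> ->; rewrite subrr.
Qed.

End L2Space.
(** * Tensors in the L^2 space of a product *)

Section Tensor.
Context d1 d2 (T1 : measurableType d1) (T2 : measurableType d2) (R : realType).
Variables (rho1 : probability T1 R) (rho2 : probability T2 R).
Local Notation rho := (rho1 \x rho2)%E.

Definition tensor (f : T1 -> R[i]) (g : T2 -> R[i]) : T1 * T2 -> R[i] :=
  fun x => f x.1 * g x.2.

Lemma cmeasurable_tensor f g : cmeasurable f -> cmeasurable g ->
  cmeasurable (tensor f g).
Proof.
move=> [rf jf] [rg jg].
have F (u : T1 -> R) : measurable_fun setT u ->
    measurable_fun setT (fun x : T1 * T2 => u x.1).
  by move=> mu; exact: measurableT_comp.
have G (u : T2 -> R) : measurable_fun setT u ->
    measurable_fun setT (fun x : T1 * T2 => u x.2).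
  by move=> mu; exact: measurableT_comp.
split.
  rewrite (_ : (fun x => _) = fun x =>
      complex.Re (f x.1) * complex.Re (g x.2) -
      complex.Im (f x.1) * complex.Im (g x.2)).
    exact: (measurable_funB (measurable_funM (F _ rf) (G _ rg))
                            (measurable_funM (F _ jf) (G _ jg))).
  by apply/funext => x; rewrite /tensor; case: (f _) (g _) => ? ? [].
rewrite (_ : (fun x => _) = fun x =>
    complex.Re (f x.1) * complex.Im (g x.2) +
    complex.Im (f x.1) * complex.Re (g x.2)).
  exact: (measurable_funD (measurable_funM (F _ rf) (G _ jg))
                          (measurable_funM (F _ jf) (G _ rg))).
by apply/funext => x; rewrite /tensor; case: (f _) (g _) => ? ? [].
Qed.

Lemma L2_tensor f g : L2 rho1 f -> L2 rho2 g -> L2 rho (tensor f g).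
Proof.
move=> /L2P[mf sf] /L2P[mg sg]; apply/L2P.
have mt := cmeasurable_tensor mf mg; split=> //.
apply/integrable12ltyP.
  by apply/measurable_EFinP; exact: measurable_sqmod.
under eq_integral => x _.
  under eq_integral => y _.
    rewrite /= /tensor sqmodM normrM !ger0_norm ?sqmod_ge0// EFinM.
    over.
  rewrite /= ge0_integralZl ?lee_fin ?sqmod_ge0//; last 2 first.
    by apply/measurable_EFinP; exact: measurable_sqmod.
    by move=> *; rewrite lee_fin sqmod_ge0.
  over.
have f_fin := integrable_fin_num measurableT sf.
have g_fin := integrable_fin_num measurableT sg.
rewrite /= ge0_integralZr//.
- rewrite -ge0_fin_numE ?mule_ge0 ?integral_ge0//; try by move=> *; rewrite lee_fin sqmod_ge0.
  exact: fin_numM f_fin g_fin.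
- by apply/measurable_EFinP; exact: measurable_sqmod.
- by move=> *; rewrite lee_fin sqmod_ge0.
- by apply: integral_ge0 => *; rewrite lee_fin sqmod_ge0.
Qed.

(** The integral of a slice is infinite on a null set only, so taking its finite
    part, as [Rintegral] does, does not affect the iterated integral. *)
Section RealFubini.
Variable u : T1 * T2 -> R.
Hypothesis iu : rho.-integrable setT (EFin \o u).
Let U := fun x => (\int[rho2]_y u (x, y))%R.

Lemma measurable_slice_Rintegral : measurable_fun setT U.
Proof.
rewrite (_ : U = fine \o fubini_F rho2 (EFin \o u))//.
apply: measurableT_comp => //; exact: measurable_fubini_F iu.
Qed.

Lemma integrable_slice_Rintegral : rho1.-integrable setT (EFin \o U).
Proof.
apply: le_integrable (integrable_fubini_F iu) => //.
  by apply/measurable_EFinP; exact: measurable_slice_Rintegral.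
have le_fine (e : \bar R) : (`|(fine e)%:E| <= `|e|)%E.
  by case: e => //=; rewrite normr0 leey.
by move=> x _; exact: le_fine.
Qed.

Lemma Rintegral_slice : (\int[rho]_z u z = \int[rho1]_x U x)%R.
Proof.
rewrite /Rintegral -integral12_prod_meas1//; congr fine.
apply: ae_eq_integral => //; first exact: measurable_int (integrable_fubini_F iu).
  by apply/measurable_EFinP; exact: measurable_slice_Rintegral.
apply: filterS (integrable_ae measurableT (integrable_fubini_F iu)) => x /= /(_ I) xfin _.
by rewrite /U /Rintegral fineK.
Qed.

End RealFubini.

Lemma cintegrable_slice F : cintegrable rho F ->
  cintegrable rho1 (fun x => cint rho2 (fun y => F (x, y))).
Proof.
move=> [rF iF]; split.
  exact: (integrable_slice_Rintegral rF).
exact: (integrable_slice_Rintegral iF).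
Qed.

Lemma cint_slice F : cintegrable rho F ->
  cint rho F = cint rho1 (fun x => cint rho2 (fun y => F (x, y))).
Proof. by move=> [rF iF]; rewrite /cint (Rintegral_slice rF) (Rintegral_slice iF). Qed.

Lemma ae_cintegrable_slice F : cintegrable rho F ->
  {ae rho1, forall x, cintegrable rho2 (fun y => F (x, y))}.
Proof.
move=> [rF iF]; apply: filterS2 (ae_integrable1 rF) (ae_integrable1 iF) => x.
by [].
Qed.

Lemma ae_L2_slice w : L2 rho w -> {ae rho1, forall x, L2 rho2 (fun y => w (x, y))}.
Proof.
move=> /L2P[[rw jw] sw].
apply: filterS (ae_integrable1 sw) => x sx; apply/L2P; split=> //; split.
  exact: (measurableT_comp rw (measurable_pair1 x)).
exact: (measurableT_comp jw (measurable_pair1 x)).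
Qed.

(** The integrand is the product of w and of the conjugate of 1 (x) g. *)
Lemma cintegrable_mul_snd w g : L2 rho w -> L2 rho2 g ->
  cintegrable rho (fun z => w z * conjc (g z.2)).
Proof.
move=> w2 g2; have one2 : L2 rho1 (fun=> 1) by split; exact: Lfun_cst.
have := L2_conjM_cintegrable w2 (L2_tensor one2 g2).
rewrite (_ : (fun z => w z * conjc (tensor _ _ _)) = fun z => w z * conjc (g z.2))//.
by apply/funext => z; rewrite /tensor mul1r.
Qed.

Lemma sqmod_dotL2 d (T : measurableType d) (mu : {measure set T -> \bar R}) f g :
  L2 mu f -> L2 mu g -> sqmod (dotL2 mu f g) <= normL2 mu f ^+ 2 * normL2 mu g ^+ 2.
Proof.
move=> f2 g2; have := CauchySchwarz (L2_semi_inner mu) f2 g2.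
rewrite -lecR add_Re2_Im2 -exprMn [(_ ^+ 2)%:C]realCM -expr2 => h.
by rewrite ler_pXn2r// ?nnegrE// (le_trans (normr_ge0 _) h).
Qed.

(** By Cauchy-Schwarz, |<w(x, .), g>|^2 is at most |g|^2 times the integral of
    |w(x, .)|^2, which is integrable in x. *)
Lemma L2_slice_dot w g : L2 rho w -> L2 rho2 g ->
  L2 rho1 (fun x => dotL2 rho2 (fun y => w (x, y)) g).
Proof.
move=> w2 g2; have [rF jF] := cintegrable_mul_snd w2 g2.
set h := fun x => _.
have mh : cmeasurable h.
  split; first exact: (measurable_slice_Rintegral rF).
  exact: (measurable_slice_Rintegral jF).
apply/L2P; split=> //; apply/integrableP; split.
  by apply/measurable_EFinP; exact: measurable_sqmod.
have /L2P[mw sw] := w2.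
pose k := normL2 rho2 g ^+ 2; have k0 : 0 <= k by rewrite sqr_ge0.
pose S x := (\int[rho2]_y (sqmod (w (x, y)))%:E)%E.
have S0 x : (0 <= S x)%E by apply: integral_ge0 => *; rewrite lee_fin sqmod_ge0.
have mS : measurable_fun setT S := measurable_fubini_F sw.
have IS : (\int[rho1]_x S x = \int[rho]_z (sqmod (w z))%:E)%E := integral12_prod_meas1 sw.
have : (\int[rho1]_x (k%:E * S x) < +oo)%E.
  rewrite ge0_integralZl// IS -ge0_fin_numE ?fin_numM//.
  - exact: integrable_fin_num sw.
  - by rewrite mule_ge0 ?lee_fin//; apply: integral_ge0 => *; rewrite lee_fin sqmod_ge0.
apply: le_lt_trans; apply: ae_ge0_le_integral => //.
- by apply: measurableT_comp => //; apply/measurable_EFinP; exact: measurable_sqmod.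
- by move=> x _; rewrite mule_ge0.
- exact: measurable_funeM.
apply: filterS2 (ae_L2_slice w2) (ae_integrable1 sw) => x wx swx _.
rewrite /= ger0_norm ?sqmod_ge0// -[S x]fineK; last exact: integrable_fin_num swx.
rewrite -EFinM lee_fin mulrC (le_trans (sqmod_dotL2 wx g2))//.
by rewrite normL2_sqr.
Qed.

Lemma dotL2_tensor_slice w f g : L2 rho w -> L2 rho1 f -> L2 rho2 g ->
  dotL2 rho w (tensor f g) =
    dotL2 rho1 (fun x => dotL2 rho2 (fun y => w (x, y)) g) f.
Proof.
move=> w2 f2 g2; have t2 := L2_tensor f2 g2.
have wt := L2_conjM_cintegrable w2 t2.
rewrite [LHS]dotL2E cint_slice// dotL2E; apply: ae_eq_cint.
- exact: (cintegrable_slice wt).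
- by apply: L2_conjM_cintegrable => //; exact: L2_slice_dot.
apply: filterS (ae_cintegrable_slice (cintegrable_mul_snd w2 g2)) => x wg.
rewrite dotL2E mulrC -cintZ//; congr cint; apply/funext => y.
by rewrite /tensor conjcM mulrCA.
Qed.

Lemma dotL2_tensor f g f' g' : L2 rho1 f -> L2 rho2 g -> L2 rho1 f' -> L2 rho2 g' ->
  dotL2 rho (tensor f g) (tensor f' g') = dotL2 rho1 f f' * dotL2 rho2 g g'.
Proof.
move=> f2 g2 f'2 g'2; rewrite dotL2_tensor_slice//; last exact: L2_tensor.
rewrite mulrC -(dotZl (L2_semi_inner rho1) _ f2 f'2).
congr (dotL2 rho1 _ _); apply/funext => x.
rewrite (_ : (fun y => tensor f g (x, y)) = f x *: g)//.
by rewrite (dotZl (L2_semi_inner rho2))// mulrC.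
Qed.

Lemma normL2_tensor f g : L2 rho1 f -> L2 rho2 g ->
  normL2 rho (tensor f g) = normL2 rho1 f * normL2 rho2 g.
Proof.
move=> f2 g2; apply/eqP; rewrite -(@eqrXn2 _ 2) ?mulr_ge0 ?snorm_ge0//.
apply/eqP/(@complexI R); have := dotL2_tensor f2 g2 f2 g2.
rewrite (dotE (L2_semi_inner rho1) f2) (dotE (L2_semi_inner rho2) g2).
by rewrite (dotE (L2_semi_inner rho) (L2_tensor f2 g2)) -realCM -exprMn.
Qed.

(** For each (n, k) the function x |-> <w(x, .), psi n k> is orthogonal to the
    complete family E, so it is 0 almost everywhere. The family psi is indexed by
    a countable set for the exceptional null sets to have a null union; outside
    of it the slice w(x, .) is orthogonal to the complete family psi. *)
Lemma tensor_complete (E : set (T1 -> R[i])) (psi : nat -> nat -> T2 -> R[i]) w :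
  (forall f, E f -> L2 rho1 f) -> (forall n k, L2 rho2 (psi n k)) ->
  (forall h, L2 rho1 h -> (forall f, E f -> dotL2 rho1 h f = 0) ->
    normL2 rho1 h = 0) ->
  (forall h, L2 rho2 h -> (forall n k, dotL2 rho2 h (psi n k) = 0) ->
    normL2 rho2 h = 0) ->
  L2 rho w ->
  (forall f n k, E f -> dotL2 rho w (tensor f (psi n k)) = 0) ->
  normL2 rho w = 0.
Proof.
move=> E2 psi2 Ec psic w2 worth.
have ae0 : {ae rho1, forall x, forall n k, dotL2 rho2 (fun y => w (x, y)) (psi n k) = 0}.
  apply: ae_foralln => n; apply: ae_foralln => k.
  apply/(normL2_eq0 (L2_slice_dot w2 (psi2 n k))).
  apply: Ec => [|f Ef]; first exact: L2_slice_dot.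
  by rewrite -dotL2_tensor_slice ?worth//; exact: E2.
have /L2P[mw sw] := w2.
apply/eqP; rewrite -sqrf_eq0 normL2_sqr /Rintegral -integral12_prod_meas1//.
rewrite (@ae_eq_integral _ _ _ rho1 setT (cst 0%E))//.
- by rewrite integral0.
- exact: measurable_fubini_F sw.
apply: filterS3 ae0 (ae_L2_slice w2) (ae_integrable1 sw) => x x0 wx swx _.
rewrite /= /fubini_F /= -[LHS]fineK; last exact: integrable_fin_num swx.
have /(congr1 (fun r => r ^+ 2)) := psic _ wx x0.
by rewrite normL2_sqr expr0n /= /Rintegral => ->.
Qed.

End Tensor.
(** * Spectrum of a tensor sum *)

Section Operators.
Context d (T : measurableType d) (R : realType).
Variable mu : {measure set T -> \bar R}.
Variable G : operator_graph T R.
Local Notation ip := (L2_semi_inner mu).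

Lemma self_adjoint_symmetric : self_adjoint mu G ->
  symmetric_operator (L2 mu) (dotL2 mu) G.
Proof.
move=> [[dom eqG single G0 lin] _ adj].
have aeqxx f : aeq mu f f by exact: aeW.
split=> //.
- move=> f g fg f0; have [f2 g2] := dom _ _ fg.
  apply/(normL2_eq0 g2); apply: (single (fun=> 0)) => //.
  by apply: eqG fg => //; [exact: L2_0|exact/(normL2_eq0 f2)].
- move=> f g g' fg g'2 gg'; have [f2 g2] := dom _ _ fg.
  by apply: eqG fg => //; exact/(aeq_normL2 g2 g'2).
- by move=> f g f' g' fg /adj[_ _]; exact.
Qed.

Hypothesis sa : self_adjoint mu G.
Local Notation so := (self_adjoint_symmetric sa).

Lemma resolventE z h f : resolvent mu G z h f <-> L2 mu h /\ G f (h + z *: f).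
Proof.
split=> [[h2 [g [fg hg]]]|[h2 fg]]; split=> //.
  have [f2 g2] := so_dom so fg.
  have hzf2 : L2 mu (h + z *: f) by apply: (siD ip) => //; exact: (siZ ip).
  apply: (so_eqr so fg hzf2); apply/(aeq_normL2 g2 hzf2).
  by apply: filterS hg => x; rewrite !fctE => ->; rewrite /= subrK.
exists (h + z *: f); split=> //; apply: aeW => x; rewrite !fctE.
by rewrite addrK.
Qed.

Lemma eigenfunction_L2 z f : eigenfunction G z f -> L2 mu f.
Proof. by move=> /(so_dom so)[]. Qed.

Lemma dotL2_eigenfunction z f g g' : eigenfunction G z f -> G g g' ->
  dotL2 mu g' f = conjc z * dotL2 mu g f.
Proof.
move=> ef gg'; rewrite (so_sym so gg' ef).
have [g2 _] := so_dom so gg'.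
exact: (dotZr ip z (eigenfunction_L2 ef) g2).
Qed.

Lemma eigenfunctions_complete : compact_resolvent mu G -> forall h, L2 mu h ->
  (forall z f, eigenfunction G z f -> dotL2 mu h f = 0) -> normL2 mu h = 0.
Proof.
move=> [z [[surj _ [C bnd]] cpt]] h h2 horth.
apply: (@eigen_orthogonal_null _ _ _ _ _ ip so z C) => //.
- by move=> k /surj[f /resolventE[_ ?]]; exists f.
- by move=> k f k2 kf; apply: bnd; exact/resolventE.
- by move=> k f kf kB; apply: (cpt k) => // n; apply/resolventE; exact: kf.
Qed.

(** Bases of the eigenspaces. The second index runs over all natural numbers, and
    psi i k is 0 beyond the multiplicity of nu i. *)
Lemma countable_eigenfunctions nu : distinct_eigenvalues mu G nu ->
  exists psi : nat -> nat -> T -> R[i],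
    (forall i k, eigenfunction G (nu i)%:C (psi i k)) /\
    (forall h, L2 mu h -> (forall i k, dotL2 mu h (psi i k) = 0) ->
      forall z f, eigenfunction G z f -> dotL2 mu h f = 0).
Proof.
move=> [_ _ ev fin].
have /choice[psi psiP] : forall i, exists psi : nat -> T -> R[i],
    (forall k, eigenfunction G (nu i)%:C (psi k)) /\
    (forall h, L2 mu h -> (forall k, dotL2 mu h (psi k) = 0) ->
      forall f, eigenfunction G (nu i)%:C f -> dotL2 mu h f = 0).
  move=> i; have [m [e [eG _ span]]] := fin i.
  exists (fun k => if insub k is Some l then e l else 0); split=> [k|h h2 he f ef].
    case: insub => // ; rewrite /eigenfunction.
    rewrite (_ : (fun x => _) = 0); first exact: so0 so.
    by apply/funext => x; exact: mulr0.
  have [a fa] := span _ ef; have f2 := eigenfunction_L2 ef.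
  have e2 k : L2 mu (e k) by exact: eigenfunction_L2 (eG k).
  have s2 : L2 mu (\sum_k a k *: e k) by apply: (si_sum ip) => ? _; exact: (siZ ip).
  rewrite (dot_eqr ip f2 s2 h2).
    rewrite (dot_sumr ip)// big1// => k _.
    by have := he k; rewrite valK => ->; rewrite mulr0.
  apply/(aeq_normL2 f2 s2); apply: filterS fa => x ->.
  by rewrite fct_sumE; apply: eq_bigr.
exists psi; split=> [i k|h h2 hpsi z f ef]; first by have [] := psiP i.
have f2 := eigenfunction_L2 ef.
have [f0|f0] := pselect (aeq mu f (fun=> 0)).
  by apply: (dot_null ip) => //; exact/normL2_eq0.
have [i zi] : exists i, z = (nu i)%:C by apply/ev; exists f.
by have [_ /(_ h h2 (hpsi i) f)] := psiP i; apply; rewrite -zi.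
Qed.

End Operators.
Section TensorSumSpectrum.
Context d1 d2 (T1 : measurableType d1) (T2 : measurableType d2) (R : realType).
Variables (rho1 : probability T1 R) (rho2 : probability T2 R).
Variables (G1 : operator_graph T1 R) (G2 : operator_graph T2 R).
Hypotheses (sa1 : self_adjoint rho1 G1) (sa2 : self_adjoint rho2 G2).
Local Notation rho := (rho1 \x rho2)%E.
Local Notation ip1 := (L2_semi_inner rho1).
Local Notation ip2 := (L2_semi_inner rho2).
Local Notation ip := (L2_semi_inner rho).
Local Notation so1 := (self_adjoint_symmetric sa1).
Local Notation so2 := (self_adjoint_symmetric sa2).

Lemma eigenfunction_tensor z1 z2 f g :
  eigenfunction G1 z1 f -> eigenfunction G2 z2 g ->
  eigenfunction (tensor_sum rho1 rho2 G1 G2) (z1 + z2) (tensor f g).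
Proof.
move=> ef eg; have f2 := eigenfunction_L2 sa1 ef; have g2 := eigenfunction_L2 sa2 eg.
have t2 := L2_tensor f2 g2.
split=> // [|e e0]; first exact: (siZ ip).
exists (tensor f g), (fun x => (z1 + z2) * tensor f g x); split.
- exists 1, (fun=> f), (fun=> (fun x => z1 * f x)), (fun=> g), (fun=> (fun x => z2 * g x)).
  split=> //; apply/funext => x; rewrite big_ord1 //.
  by rewrite /tensor; ring.
- rewrite (_ : (fun x => _) = 0); first by rewrite [normL2 _ _](snorm0 ip).
  by apply/funext => x; exact: subrr.
- rewrite (_ : (fun x => _) = 0); first by rewrite [normL2 _ _](snorm0 ip).
  by apply/funext => x; exact: subrr.
Qed.

Lemma algebraic_tensor_sum_dot u v z1 z2 f g :
  eigenfunction G1 z1 f -> eigenfunction G2 z2 g ->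
  algebraic_tensor_sum G1 G2 u v ->
  [/\ L2 rho u, L2 rho v &
    dotL2 rho v (tensor f g) = (conjc z1 + conjc z2) * dotL2 rho u (tensor f g)].
Proof.
move=> ef eg [n [a [a' [b [b' [Gab -> ->]]]]]].
have f2 := eigenfunction_L2 sa1 ef; have g2 := eigenfunction_L2 sa2 eg.
have t2 := L2_tensor f2 g2.
have ab2 k : [/\ L2 rho1 (a k), L2 rho1 (a' k), L2 rho2 (b k) & L2 rho2 (b' k)].
  by have [/(so_dom so1)[? ?] /(so_dom so2)[? ?]] := Gab k.
have tt2 k : L2 rho (tensor (a k) (b k)) by have [? _ ? _] := ab2 k; exact: L2_tensor.
have t'2 k : L2 rho (tensor (a' k) (b k) + tensor (a k) (b' k)).
  by have [? ? ? ?] := ab2 k; apply: (siD ip); exact: L2_tensor.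
have -> : (fun x : T1 * T2 => \sum_k a k x.1 * b k x.2) = \sum_k 1 *: tensor (a k) (b k).
  by apply/funext => x; rewrite fct_sumE; apply: eq_bigr => k _; rewrite scale1r.
have -> : (fun x : T1 * T2 => \sum_k (a' k x.1 * b k x.2 + a k x.1 * b' k x.2)) =
    \sum_k 1 *: (tensor (a' k) (b k) + tensor (a k) (b' k)).
  by apply/funext => x; rewrite fct_sumE; apply: eq_bigr => k _; rewrite scale1r.
split; [by apply: (si_sum ip) => k _; exact: (siZ ip)..|].
rewrite !(dot_suml ip)// mulr_sumr; apply: eq_bigr => k _.
have [ak ak' bk bk'] := ab2 k; have [Ga Gb] := Gab k.
rewrite (dotDl ip) ?dotL2_tensor//; try exact: L2_tensor.
rewrite (dotL2_eigenfunction sa1 ef Ga) (dotL2_eigenfunction sa2 eg Gb).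
by ring.
Qed.

(** On the algebraic tensor sum, symmetry of the factors gives
    <v, f (x) g> = (conj z1 + conj z2) <u, f (x) g>, and this passes to the closure;
    for v = z u it forces <u, f (x) g> = 0. *)
Lemma tensor_sum_orth z u z1 z2 f g :
  eigenfunction (tensor_sum rho1 rho2 G1 G2) z u ->
  eigenfunction G1 z1 f -> eigenfunction G2 z2 g ->
  z != conjc z1 + conjc z2 -> dotL2 rho u (tensor f g) = 0.
Proof.
move=> [u2 v2 approx] ef eg zz.
have f2 := eigenfunction_L2 sa1 ef; have g2 := eigenfunction_L2 sa2 eg.
have t2 := L2_tensor f2 g2; set mu := conjc z1 + conjc z2 in zz *.
suff : (z - mu) * dotL2 rho u (tensor f g) = 0.
  by move/eqP; rewrite mulf_eq0 subr_eq0 (negPf zz) => /eqP.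
apply: (dot_small0 ip t2) => e e0.
(* K bounds the norm of (z u - v') - mu (u - u') in terms of the two errors *)
pose K := 1 + Num.sqrt (complex.Re mu ^+ 2 + complex.Im mu ^+ 2).
have K0 : 0 < K by rewrite ltr_pwDl// sqrtr_ge0.
have [u' [v' [alg uu' vv']]] := approx _ (divr_gt0 e0 K0).
have [u'2 v'2 e'] := algebraic_tensor_sum_dot ef eg alg.
have zu2 : L2 rho (z *: u) by exact: (siZ ip).
have du2 : L2 rho (u - u') by exact: (siB ip).
have dv2 : L2 rho (z *: u - v') by exact: (siB ip).
exists ((z *: u - v') - mu *: (u - u')); split.
- by apply: (siB ip) => //; exact: (siZ ip).
- rewrite (le_lt_trans (snormD ip _ _))//; [exact/(siN ip)/(siZ ip)|].
  rewrite (snormN ip); last exact: (siZ ip).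
  rewrite (snormZE ip)//.
  have -> : e = e / K + Num.sqrt (complex.Re mu ^+ 2 + complex.Im mu ^+ 2) * (e / K).
    by rewrite -[X in X + _]mul1r -mulrDl -/K mulrC divfK// gt_eqF.
  apply: ltr_leD; first exact: vv'.
  by rewrite ler_wpM2l ?sqrtr_ge0// ltW//; exact: uu'.
- rewrite (dotBl ip)//; last exact: (siZ ip).
  rewrite (dotBl ip zu2 v'2 t2) (dotZl ip)// (dotZl ip)// (dotBl ip)// e'.
  have alg_id (a b x y : R[i]) : a * x - b * y - b * (x - y) = (a - b) * x by ring.
  exact: alg_id.
Qed.

Lemma dotL2_tensor_sum_eq0 w m1 m2 (e1 : 'I_m1 -> T1 -> R[i]) (e2 : 'I_m2 -> T2 -> R[i])
    (c1 : 'I_m1 -> R[i]) (c2 : 'I_m2 -> R[i]) :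
  L2 rho w -> (forall k, L2 rho1 (e1 k)) -> (forall l, L2 rho2 (e2 l)) ->
  (forall k l, dotL2 rho w (tensor (e1 k) (e2 l)) = 0) ->
  dotL2 rho w (tensor (\sum_k c1 k *: e1 k) (\sum_l c2 l *: e2 l)) = 0.
Proof.
move=> w2 e12 e22 w0.
have tt2 (p : 'I_m1 * 'I_m2) : L2 rho (tensor (e1 p.1) (e2 p.2)) by exact: L2_tensor.
have -> : tensor (\sum_k c1 k *: e1 k) (\sum_l c2 l *: e2 l) =
    \sum_(p : 'I_m1 * 'I_m2) (c1 p.1 * c2 p.2) *: tensor (e1 p.1) (e2 p.2).
  apply/funext => x; rewrite /tensor !fct_sumE mulr_suml.
  rewrite -(pair_bigA _ (fun k l => (c1 k * c2 l) * (e1 k x.1 * e2 l x.2))) /=.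
  apply: eq_bigr => k _; rewrite mulr_sumr; apply: eq_bigr => l _.
  by rewrite mulrACA.
by rewrite (dot_sumr ip)// big1// => p _; rewrite w0 mulr0.
Qed.

Lemma dotL2_tensor_aeq w f f' g g' : L2 rho w -> L2 rho1 f -> L2 rho1 f' ->
  L2 rho2 g -> L2 rho2 g' -> aeq rho1 f f' -> aeq rho2 g g' ->
  dotL2 rho w (tensor f g) = dotL2 rho w (tensor f' g').
Proof.
move=> w2 f2 f'2 g2 g'2 ff' gg'.
have ff2 := siB ip1 f2 f'2; have gg2 := siB ip2 g2 g'2.
apply: (dot_eqr ip) => //; try exact: L2_tensor.
have -> : tensor f g - tensor f' g' = tensor (f - f') g + tensor f' (g - g').
  apply/funext => x.
  change (f x.1 * g x.2 - f' x.1 * g' x.2 =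
    (f x.1 - f' x.1) * g x.2 + f' x.1 * (g x.2 - g' x.2)).
  by ring.
apply/eqP; rewrite eq_le snorm_ge0 andbT.
rewrite (le_trans (snormD ip (L2_tensor _ _) (L2_tensor _ _)))//.
rewrite [snorm _ (tensor _ g)](normL2_tensor ff2 g2).
rewrite [snorm _ (tensor f' _)](normL2_tensor f'2 gg2).
have /(aeq_normL2 f2 f'2) -> := ff'; have /(aeq_normL2 g2 g'2) -> := gg'.
by rewrite mul0r mulr0 addr0.
Qed.

(** The Gram matrix of the tensors is the Kronecker product of the two Gram
    matrices, here in the form of its action on a matrix of coefficients. *)
Lemma dotL2_sum_tensor m1 m2 (e1 : 'I_m1 -> T1 -> R[i]) (e2 : 'I_m2 -> T2 -> R[i])
    (A : 'M[R[i]]_(m1, m2)) k l :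
  (forall k, L2 rho1 (e1 k)) -> (forall l, L2 rho2 (e2 l)) ->
  dotL2 rho (\sum_(p : 'I_m1 * 'I_m2) A p.1 p.2 *: tensor (e1 p.1) (e2 p.2))
      (tensor (e1 k) (e2 l)) =
    ((\matrix_(i, j) dotL2 rho1 (e1 i) (e1 j))^T *m A *m
     (\matrix_(i, j) dotL2 rho2 (e2 i) (e2 j))) k l.
Proof.
move=> e12 e22; rewrite (dot_suml ip); last 2 first.
- by move=> p; exact: L2_tensor.
- exact: L2_tensor.
rewrite -(pair_bigA _ (fun i j => A i j *
  dotL2 rho (tensor (e1 i) (e2 j)) (tensor (e1 k) (e2 l)))) /=.
rewrite exchange_big mxE; apply: eq_bigr => j _; rewrite mxE mulr_suml.
apply: eq_bigr => i _; rewrite !mxE dotL2_tensor//.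
by rewrite mulrCA mulrA.
Qed.

(** An eigenfunction u is compared with the combination u0 of the tensors
    e1 k (x) e2 l that has the same inner products with all of them. The difference
    u - u0 is orthogonal to f (x) g for all eigenfunctions f and g: by this choice
    if the eigenvalues are nu1 i and nu2 j, and otherwise because their sum
    differs from nu1 i + nu2 j. *)
Lemma multiplicity_tensor_sum (nu1 nu2 : nat -> R) (i j m1 m2 : nat) :
  compact_resolvent rho1 G1 -> compact_resolvent rho2 G2 ->
  distinct_eigenvalues rho1 G1 nu1 -> distinct_eigenvalues rho2 G2 nu2 ->
  (forall i' j', nu1 i' + nu2 j' = nu1 i + nu2 j -> i' = i /\ j' = j) ->
  multiplicity rho1 G1 (nu1 i)%:C m1 -> multiplicity rho2 G2 (nu2 j)%:C m2 ->
  multiplicity rho (tensor_sum rho1 rho2 G1 G2) (nu1 i + nu2 j)%:C (m1 * m2)%N.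
Proof.
move=> cr1 cr2 ev1 ev2 nocoinc [e1 [e1G e1free e1span]] [e2 [e2G e2free e2span]].
have e12 k : L2 rho1 (e1 k) := eigenfunction_L2 sa1 (e1G k).
have e22 l : L2 rho2 (e2 l) := eigenfunction_L2 sa2 (e2G l).
have tt2 k l : L2 rho (tensor (e1 k) (e2 l)) by exact: L2_tensor.
pose Gam1 := \matrix_(i, j) dotL2 rho1 (e1 i) (e1 j).
pose Gam2 := \matrix_(i, j) dotL2 rho2 (e2 i) (e2 j).
have U1 : Gam1^T \in unitmx.
  rewrite unitmx_tr; apply: (Gram_unit ip1) => // a a0; apply: e1free.
  have s2 : L2 rho1 (\sum_k a k *: e1 k).
    by apply: (si_sum ip1) => ? _; exact: (siZ ip1).
  have /(normL2_eq0 s2) := a0; apply: filterS => x.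
  by rewrite fct_sumE.
have U2 : Gam2 \in unitmx.
  apply: (Gram_unit ip2) => // a a0; apply: e2free.
  have s2 : L2 rho2 (\sum_k a k *: e2 k).
    by apply: (si_sum ip2) => ? _; exact: (siZ ip2).
  have /(normL2_eq0 s2) := a0; apply: filterS => x.
  by rewrite fct_sumE.
have [idx idxK Kidx] := @curry_mxvec_bij m1 m2.
have idxP k l : idx (mxvec_index k l) = (k, l) by exact: (idxK (k, l)).
have Pidx k : mxvec_index (idx k).1 (idx k).2 = k.
  by have := Kidx k isT; case: (idx k).
pose e (k : 'I_(m1 * m2)) := tensor (e1 (idx k).1) (e2 (idx k).2).
have eE (a : 'I_(m1 * m2) -> R[i]) (A : 'M[R[i]]_(m1, m2)) :
    (forall k l, A k l = a (mxvec_index k l)) ->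
    (fun x => \sum_k a k * e k x) =
      \sum_(p : 'I_m1 * 'I_m2) A p.1 p.2 *: tensor (e1 p.1) (e2 p.2).
  move=> Aa; apply/funext => x; rewrite fct_sumE.
  rewrite (reindex (uncurry (@mxvec_index m1 m2))); last first.
    by exists idx => [[k l] _|k _]; [exact: idxP|exact: Kidx].
  by apply: eq_bigr => -[k l] _; rewrite /e /= idxP /= -Aa.
have s2 (A : 'M[R[i]]_(m1, m2)) :
    L2 rho (\sum_(p : 'I_m1 * 'I_m2) A p.1 p.2 *: tensor (e1 p.1) (e2 p.2)).
  by apply: (si_sum ip) => p _; exact: (siZ ip).
have nuC (k l : nat) : (nu1 k + nu2 l)%:C = (nu1 k)%:C + (nu2 l)%:C :> R[i].
  exact: (rmorphD (real_complex R)).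
have te k l : eigenfunction (tensor_sum rho1 rho2 G1 G2) (nu1 i + nu2 j)%:C
    (tensor (e1 k) (e2 l)).
  by rewrite nuC; exact: eigenfunction_tensor.
exists e; split=> [k|a a0 k|u eu].
- exact: te.
- pose A : 'M[R[i]]_(m1, m2) := \matrix_(k, l) a (mxvec_index k l).
  have AE k' l' : A k' l' = a (mxvec_index k' l') by rewrite mxE.
  have A0 : Gam1^T *m A *m Gam2 = 0.
    apply/matrixP => k' l'; rewrite -dotL2_sum_tensor// -(eE a)// mxE.
    rewrite (si_dotC ip) (dot_null ip) ?conjc0//.
      by rewrite (eE a A).
    by apply/normL2_eq0 => //; rewrite (eE a A).
  have : A = 0.
    by rewrite -[A](mulKmx U1) -[_ *m A](mulmxK U2) A0 mul0mx mulmx0.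
  by rewrite -(Pidx k) -AE => ->; rewrite mxE.
have u2 : L2 rho u by case: eu.
pose B : 'M[R[i]]_(m1, m2) := \matrix_(k, l) dotL2 rho u (tensor (e1 k) (e2 l)).
(* u0 has inner products Gam1^T *m A *m Gam2 with the tensors of the bases *)
pose A := invmx Gam1^T *m B *m invmx Gam2.
set u0 := \sum_(p : 'I_m1 * 'I_m2) A p.1 p.2 *: tensor (e1 p.1) (e2 p.2).
have u02 : L2 rho u0 := s2 A.
have w2 := siB ip u2 u02.
have worth k l : dotL2 rho (u - u0) (tensor (e1 k) (e2 l)) = 0.
  rewrite (dotBl ip)// dotL2_sum_tensor// -/Gam1 -/Gam2 /A.
  by rewrite !mulmxA mulmxV// mul1mx mulmxKV// mxE subrr.
exists (fun k => A (idx k).1 (idx k).2).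
rewrite (eE _ A); last by move=> k l; rewrite idxP.
apply/(aeq_normL2 u2 u02).
have [psi [psiG psic]] := countable_eigenfunctions sa2 ev2.
have psi2 n k : L2 rho2 (psi n k) := eigenfunction_L2 sa2 (psiG n k).
apply: (@tensor_complete _ _ _ _ _ rho1 rho2
  [set f | exists z, eigenfunction G1 z f] psi).
- by move=> f [z ef]; exact: eigenfunction_L2 ef.
- exact: psi2.
- move=> h h2 horth; apply: (eigenfunctions_complete sa1 cr1 h2) => z f ef.
  by apply: horth; exists z.
- move=> h h2 horth; apply: (eigenfunctions_complete sa2 cr2 h2).
  exact: psic.
- exact: w2.
move=> f n k [z ef].
have f2 := eigenfunction_L2 sa1 ef.
have [f0|f0] := pselect (aeq rho1 f (fun=> 0)).
  apply: (dot_null ip) => //; first exact: L2_tensor.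
  rewrite [LHS](normL2_tensor f2 (psi2 n k)) (_ : normL2 rho1 f = 0) ?mul0r//.
  exact/normL2_eq0.
have [i' zi'] : exists i', z = (nu1 i')%:C.
  by have [_ _ evP _] := ev1; apply/evP; exists f.
have [coinc|coinc] := pselect (i' = i /\ n = j).
  have [ii nj] := coinc; rewrite zi' ii in ef.
  have ep := psiG n k; rewrite nj in ep *.
  have [c1 fc1] := e1span _ ef; have [c2 pc2] := e2span _ ep.
  rewrite (@dotL2_tensor_aeq _ _ (\sum_k c1 k *: e1 k) _ (\sum_k c2 k *: e2 k))//.
  + exact: dotL2_tensor_sum_eq0.
  + by apply: (si_sum ip1) => ? _; exact: (siZ ip1).
  + by apply: (si_sum ip2) => ? _; exact: (siZ ip2).
  + by apply: filterS fc1 => x ->; rewrite fct_sumE.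
  + by apply: filterS pc2 => x ->; rewrite fct_sumE.
have ne : (nu1 i + nu2 j)%:C != conjc z + conjc (nu2 n)%:C.
  rewrite zi' !conjc_real -nuC; apply/eqP => /(@complexI R) /esym.
  by move/nocoinc.
have orth v : eigenfunction (tensor_sum rho1 rho2 G1 G2) (nu1 i + nu2 j)%:C v ->
    dotL2 rho v (tensor f (psi n k)) = 0.
  by move=> ev; apply: tensor_sum_orth ev ef (psiG n k) ne.
rewrite (dotBl ip)//; last exact: L2_tensor.
rewrite orth// sub0r (dot_suml ip)//; last exact: L2_tensor.
by rewrite big1 ?oppr0// => p _; rewrite orth ?mulr0.
Qed.

End TensorSumSpectrum.
(** * Coincidences between sums of eigenvalues *)

Section Coincidences.
Context {R : realType}.

Lemma powR_injl (alpha s t : R) : alpha != 0 -> 0 < s -> 0 < t ->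
  s `^ alpha = t `^ alpha -> s = t.
Proof.
move=> a0 s0 t0 /(congr1 (@ln R)); rewrite !ln_powR => /(mulfI a0).
by apply: ln_inj; rewrite posrE.
Qed.

Lemma countable_subsingleton (T : Type) (A : set T) :
  (forall x y, A x -> A y -> x = y) -> countable A.
Proof.
move=> A1; have [[x Ax]|A0] := pselect (exists x, A x).
  apply: sub_countable (countable1 x).
  by apply: subset_card_le => y Ay; exact: A1.
rewrite (_ : A = set0); first exact: countable0.
by rewrite -subset0 => x Ax; apply: A0; exists x.
Qed.

(** For given indices the equation has at most one solution: j' <> j, since nu1 is
    injective, and then s^alpha = (nu1 i - nu1 i') / (nu2 j' - nu2 j). *)
Lemma countable_coincidences (alpha : R) (nu1 nu2 : nat -> R) : alpha != 0 ->
  {homo nu1 : i j / (i < j)%N >-> i < j} ->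
  {homo nu2 : i j / (i < j)%N >-> i < j} ->
  countable [set s : R | 0 < s /\ exists i j i' j' : nat,
    nu1 i' + s `^ alpha * nu2 j' = nu1 i + s `^ alpha * nu2 j /\
    ~ (i' = i /\ j' = j)].
Proof.
move=> a0 mono1 mono2.
have inj (nu : nat -> R) : {homo nu : i j / (i < j)%N >-> i < j} -> injective nu.
  by move=> mono i j; case: (ltngtP i j) => // /mono + e; rewrite e ltxx.
pose B (q : (nat * nat) * (nat * nat)) := [set s : R | 0 < s /\
  nu1 q.2.1 + s `^ alpha * nu2 q.2.2 = nu1 q.1.1 + s `^ alpha * nu2 q.1.2 /\
    ~ (q.2.1 = q.1.1 /\ q.2.2 = q.1.2)].
apply: (@sub_countable _ _ _ (\bigcup_q B q)).
  apply: subset_card_le => s [s0 [i [j [i' [j' e]]]]].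
  by exists ((i, j), (i', j')).
apply: bigcup_countable => // -[[i j] [i' j']] _.
apply: countable_subsingleton => s t [/= s0 [es ne]] [t0 [et _]].
apply: (powR_injl a0 s0 t0).
have jj : nu2 j' - nu2 j != 0.
  rewrite subr_eq0; apply/eqP => jj; apply: ne; split; last exact: inj jj.
  by apply: (inj nu1) => //; move: es; rewrite jj => /addIr.
apply: (mulIf jj); move: es et; lra.
Qed.

End Coincidences.

(** * The exceptional parameters *)

Theorem proposition1 (R : realType)
  (n1 : nat) (M1 : ptopologicalType) (A1 : set (chart R n1 M1))
  (hM1 : compact_smooth_manifold A1) (rho1 : probability (borel M1) R)
  (n2 : nat) (M2 : ptopologicalType) (A2 : set (chart R n2 M2))
  (hM2 : compact_smooth_manifold A2) (rho2 : probability (borel M2) R)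
  (Delta1 : operator_graph (borel M1) R) (lambda1 : nat -> R)
  (hDelta1 : laplace_type rho1 Delta1 lambda1)
  (Delta2 : operator_graph (borel M2) R) (lambda2 : nat -> R)
  (hDelta2 : laplace_type rho2 Delta2 lambda2)
  (alpha : R) (halpha : alpha != 0)
  (Delta2s : R -> operator_graph (borel M2) R)
  (hDelta2s1 : Delta2s 1 = Delta2)
  (hDelta2s : forall s : R, 0 < s ->
    laplace_type rho2 (Delta2s s) (fun j => s `^ alpha * lambda2 j)) :
  countable [set s : R | 0 < s /\
    ~ MM rho1 rho2 Delta1 lambda1
         (Delta2s s) (fun j => s `^ alpha * lambda2 j)].
Proof.
have [sa1 _ cr1 ev1] := hDelta1; have [_ _ _ ev2] := hDelta2.
have [mono1 _ _ _] := ev1; have [mono2 _ _ _] := ev2.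
apply: sub_countable (countable_coincidences halpha mono1 mono2).
apply: subset_card_le => s [s0 notMM]; split=> //.
apply: contrapT => nocoinc; apply: notMM => i j m1 m2.
have [sa2 _ cr2 ev2s] := hDelta2s s s0.
apply: (multiplicity_tensor_sum sa1 sa2 cr1 cr2 ev1 ev2s) => i' j' e.
by apply: contrapT => ne; apply: nocoinc; exists i, j, i', j'.
Qed.
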